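(* Let $G$ be a $t$-tough graph on $n$ vertices and let $p\in[0,1]$ be such that $p^2t=\omega(\log n)$. Let $V_p$ be a $p$-random subset of $V(G)$. Then $G[V_p]$ is $\Omega(p^2t)$-tough with probability at least $1-2^{-\Omega(p^2t)}$.
   Context: All graphs are finite and simple. A graph $H$ is $s$-tough ($s\ge 0$ real) if for every $S\subseteq V(H)$ such that $H-S$ has $k\geq 2$ connected components, $|S|\geq sk$. (Complete graphs are thus $s$-tough for every $s$; by convention they have infinite toughness.) A $p$-random subset $V_p$ of $V(G)$ contains every vertex independently with probability $p$; $G[V_p]$ is the induced subgraph. Asymptotic notation is with respect to $n=|V(G)|\to\infty$: $p^2t=\omega(\log n)$ means $p^2t/\log n\to\infty$, the constants hidden in $\Omega(\cdot)$ are absolute positive constants, and the statement is for all sufficiently large $n$ (where how large may depend only on the rate of divergence in the $\omega(\cdot)$ hypothesis). *)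

(* Defs.v *)
From HB Require Import structures.
From mathcomp Require Import all_boot all_order all_algebra.
From mathcomp Require Import all_classical all_reals all_analysis.

Set Implicit Arguments.
Unset Strict Implicit.
Unset Printing Implicit Defensive.

Import Order.TTheory GRing.Theory Num.Theory.
Import numFieldNormedType.Exports.

Local Open Scope ring_scope.

(** ** Finite simple graphs *)

Record sgraph := SGraph {
  vertex :> finType;
  adj : rel vertex;
  adj_sym : symmetric adj;
  adj_irr : irreflexive adj
}.

Section Induced.
Variables (G : sgraph) (U : {set G}).

Definition induced_adj : rel {x : G | x \in U} :=
  fun x y => adj (val x) (val y).

Lemma induced_adj_sym : symmetric induced_adj.
Proof. by move=> x y; rewrite /induced_adj adj_sym. Qed.

Lemma induced_adj_irr : irreflexive induced_adj.
Proof. by move=> x; rewrite /induced_adj adj_irr. Qed.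

Definition induced_subgraph : sgraph := SGraph induced_adj_sym induced_adj_irr.

End Induced.

Definition del_vertices (G : sgraph) (S : {set G}) : sgraph :=
  induced_subgraph (finset.setC S).

Definition num_components (G : sgraph) : nat := n_comp (@adj G) G.

(** Complete graphs (including those on 0 or 1 vertices) satisfy [tough s]
    vacuously for every [s]. *)
Definition tough (R : realType) (s : R) (G : sgraph) : Prop :=
  forall S : {set G}, (2 <= num_components (del_vertices S))%N ->
    s * (num_components (del_vertices S))%:R <= #|S|%:R.

(** ** Random subsets *)

Definition mutually_independent (d : measure_display) (Omega : measurableType d)
    (R : realType) (P : probability Omega R) (I : finType)
    (E : I -> set Omega) : Prop :=
  (forall i, measurable (E i)) /\
  forall J : {set I},
    P (\bigcap_(i in [set` J]) E i)%classic = (\prod_(i in J) P (E i))%E.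

Definition random_subset (d : measure_display) (Omega : measurableType d)
    (R : realType) (P : probability Omega R) (T : finType) (p : R)
    (V : Omega -> {set T}) : Prop :=
  mutually_independent P (fun v : T => [set w | v \in V w]%classic) /\
  forall v : T, P [set w | v \in V w]%classic = p%:E.

(* Main.v *)
Require Import Defs.
From HB Require Import structures.
From mathcomp Require Import all_boot all_order all_algebra.
From mathcomp Require Import reals sequences exp ring lra.

Set Implicit Arguments.
Unset Strict Implicit.
Unset Printing Implicit Defensive.
Import Order.TTheory GRing.Theory Num.Theory.

(** Let [V] be the random vertex set.  The number of components of [G[V]] is
    bounded by its [spread], the largest size of a set [T], inside [V] or not,
    whose elements lie in pairwise different components of [G[V + T]].  Unlike
    the number of components, the spread never grows when [V] grows.

    Reduction.  Suppose that [S] violates toughness: [G[V - S]] has [k >= 2]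
    components and [#|S|] is less than a small multiple of [p^2 t k].  Keep each
    vertex of [V] with probability 1/2.  The result is a random set of density
    [p / 2] and misses [S] with probability [2^-#|S|]; if it does, its spread is
    at least [k].  No union bound over [S] is needed: it is enough to show that
    a random set of density [p] has spread [k] with probability at most
    [exp (- c p^2 t k)].  This is stated as a bound on an exponential moment of
    the spread ([moment_bound]), and is used in [violation_moment].

    The moment.  Expose the random set in many sparse rounds, after a first
    round of density at least [p / 2].  The spread drops whenever a new vertex
    is a connector, that is, sees two components of the current set
    ([spread_connector]).  If there are always [c p t k] connectors when the
    spread is [k], then while the remaining vertices, of density about [p / 4],
    arrive, the excess of the spread over 1 decays by a factor
    [exp (- c p^2 t)], which beats the number of vertices as [p^2 t] is large
    compared with [ln n].

    Connectors.  By toughness, every set that cuts [G] into [k] pieces has at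
    least [t k] vertices.  The connectors, the borders (vertices that see one
    component and have an outside neighbour which sees another) and the
    neighbours of a maximal independent set of undominated vertices form such a
    cut ([spread_cut]).  A large neighbourhood is rarely missed, even after a
    union bound over the independent sets ([rare_nbh]).  So it remains to
    exclude many borders together with few connectors ([rare_borders]).  Colour
    the components red and blue so that a quarter of the borders is red with a
    blue neighbour ([front_average]).  Adding any set [U] of such borders to the
    random set creates connectors but joins red to blue nowhere.  This spreads
    the probability of the exceptional set over exponentially many sets, and a
    Kraft inequality ([kraft]) shows that recovering [U] from the enlarged set
    costs a factor 2 per element of [U], after which each border still gains
    the factor [1 + p / 2], and a factor 2 per connector of the original set.
    As these connectors are few, exceptional sets are exponentially rare
    ([switching]). *)

(** * Connectivity inside a vertex set *)

Section Connectivity.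
Variable G : sgraph.
Implicit Types (A B I K R S T U V W X Y Z : {set G}) (a b u v w x y z : G).

Definition within A : rel G := [rel x y | [&& x \in A, y \in A & adj x y]].

Definition conn A : rel G := connect (within A).

Definition nbh A : {set G} := [set y | [exists x in A, adj x y]].

Lemma nbhP A y : reflect (exists2 x, x \in A & adj x y) (y \in nbh A).
Proof. by rewrite inE; apply: (iffP exists_inP). Qed.

Lemma nbhS A B : A \subset B -> nbh A \subset nbh B.
Proof.
move=> /subsetP sAB; apply/subsetP => y /nbhP[x xA axy].
by apply/nbhP; exists x => //; apply: sAB.
Qed.

Lemma withinE A x y : within A x y = [&& x \in A, y \in A & adj x y].
Proof. by []. Qed.

Lemma within_sym A : symmetric (within A).
Proof. by move=> x y; rewrite !withinE adj_sym andbCA. Qed.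

Lemma conn_refl A x : conn A x x.
Proof. exact: connect0. Qed.

Lemma conn_sym A x y : conn A x y = conn A y x.
Proof. by apply: sym_connect_sym; apply: within_sym. Qed.

Lemma conn_trans A : transitive (conn A).
Proof. exact: connect_trans. Qed.

Lemma conn_edge A x y : x \in A -> y \in A -> adj x y -> conn A x y.
Proof. by move=> xA yA axy; apply: connect1; rewrite withinE xA yA. Qed.

Lemma conn_ind A (P : pred G) x y :
  (forall u v, u \in A -> v \in A -> adj u v -> P u -> P v) ->
  conn A x y -> P x -> P y.
Proof.
move=> step /connectP[p]; elim: p x => [x _ -> //|z p IHp x /= /andP[exz pp] ylast Px].
have /and3P[xA zA axz] := exz.
by apply: (IHp z pp ylast); apply: step Px.
Qed.

Lemma conn_label (L : eqType) (f : G -> L) A x y :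
  (forall u v, u \in A -> v \in A -> adj u v -> f u = f v) ->
  conn A x y -> f x = f y.
Proof.
move=> lab cxy; apply/eqP/(conn_ind (P := fun z => f x == f z) _ cxy) => //.
by move=> u v uA vA auv /eqP->; apply/eqP/lab.
Qed.

Lemma conn_in A x y : conn A x y -> x != y -> (x \in A) && (y \in A).
Proof.
move=> cxy nxy.
have yA : y \in A.
  have : (y == x) || (y \in A).
    apply: (conn_ind (P := fun z => (z == x) || (z \in A)) _ cxy).
      by move=> u v _ -> _ _; rewrite orbT.
    by rewrite eqxx.
  by rewrite eq_sym (negbTE nxy).
rewrite yA andbT; move: cxy; rewrite conn_sym => cyx.
have : (x == y) || (x \in A).
  apply: (conn_ind (P := fun z => (z == y) || (z \in A)) _ cyx).
    by move=> u v _ -> _ _; rewrite orbT.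
  by rewrite eqxx.
by rewrite (negbTE nxy).
Qed.

Lemma conn_mem A x y : conn A x y -> x \in A -> y \in A.
Proof.
by move=> cxy xA; case: (eqVneq x y) => [<-//|/(conn_in cxy)/andP[]].
Qed.

Lemma connS A B x y : A \subset B -> conn A x y -> conn B x y.
Proof.
move=> /subsetP sAB; apply: connect_sub => u v /and3P[uA vA auv].
by apply: conn_edge => //; apply: sAB.
Qed.

(** Lets the undominated members of a separated set be dropped from paths. *)
Lemma conn_isolated A Z x y :
  {in Z & A :|: Z, forall z a, ~~ adj z a} -> conn (A :|: Z) x y -> conn A x y.
Proof.
move=> isoZ; apply: connect_sub => u v /and3P[uAZ vAZ auv].
apply: conn_edge => //.
  move: (uAZ); rewrite inE => /orP[//|uZ].
  by have := isoZ u v uZ vAZ; rewrite auv.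
move: (vAZ); rewrite inE => /orP[//|vZ].
by have := isoZ v u vZ uAZ; rewrite adj_sym auv.
Qed.

(** * The spread of a vertex set *)

(** [T] is allowed to leave [V]: this makes the notion antitone in [V]. *)
Definition separated V T : bool :=
  [forall x in T, forall y in T, (x != y) ==> ~~ conn (V :|: T) x y].

(** This is also the largest number of components of an induced subgraph whose
    vertex set contains [V]. *)
Definition spread V : nat := \max_(T : {set G} | separated V T) #|T|.

Lemma separatedP V T :
  reflect {in T &, forall x y, x != y -> ~~ conn (V :|: T) x y} (separated V T).
Proof.
apply: (iffP forall_inP) => [sep x y xT yT|sep x xT].
  by move/forall_inP/(_ y yT)/implyP: (sep x xT).
by apply/forall_inP => y yT; apply/implyP; apply: sep.
Qed.

Lemma leq_spread V T : separated V T -> #|T| <= spread V.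
Proof. by move=> sepT; apply: (leq_bigmax_cond (F := fun T : {set G} => #|T|)). Qed.

Lemma separatedS V V' T : V \subset V' -> separated V' T -> separated V T.
Proof.
move=> sVV' /separatedP sep; apply/separatedP => x y xT yT nxy.
by apply: contra (sep _ _ xT yT nxy); apply: connS; apply: setSU.
Qed.

Lemma separated0 V : separated V set0.
Proof. by apply/separatedP => x y; rewrite inE. Qed.

Lemma spread_attained V : exists2 T, separated V T & #|T| = spread V.
Proof.
have /(eq_bigmax_cond (fun T : {set G} => #|T|)) : 0 < #|[pred T | separated V T]|.
  by apply/card_gt0P; exists set0; apply: separated0.
by case=> T sepT eqT; exists T.
Qed.

Lemma spread_anti V V' : V \subset V' -> spread V' <= spread V.
Proof.
move=> sVV'; have [T sepT <-] := spread_attained V'.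
by apply: leq_spread; apply: separatedS sepT.
Qed.

Lemma spread_max V : spread V <= #|G|.
Proof. by have [T _ <-] := spread_attained V; apply: max_card. Qed.

(** The vertices whose addition to [V] joins components. *)
Definition connectors V : {set G} :=
  [set v | (v \notin V) &&
    [exists a in V, exists b in V, [&& adj a v, adj b v & ~~ conn V a b]]].

Lemma connectorsP V v :
  reflect (v \notin V /\ exists a b, [/\ a \in V, b \in V, adj a v, adj b v & ~~ conn V a b])
          (v \in connectors V).
Proof.
rewrite inE; apply: (iffP andP) => [[-> /exists_inP[a aV /exists_inP[b bV /and3P[? ? ?]]]]|].
  by split=> //; exists a, b.
case=> -> [a [b [aV bV av bv nab]]]; split=> //.
by apply/exists_inP; exists a => //; apply/exists_inP; exists b => //; apply/and3P.
Qed.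

(** From a set [T] separated by [V] and [v], the element of [T] that sees [v],
    if any, can be traded for one vertex in each of two components of [V]
    joined by [v]. *)
Lemma spread_connector V v : v \in connectors V -> spread (v |: V) < spread V.
Proof.
move=> /connectorsP[vV [a [b [aV bV av bv nab]]]].
have [T /separatedP sepT <-] := spread_attained (v |: V).
set W := (v |: V) :|: T in sepT.
pose K := [set t in T | conn W v t]; pose T' := [set a; b] :|: (T :\: K).
have cav : conn W a v by rewrite conn_edge // !inE ?aV ?eqxx ?orbT.
have cbv : conn W b v by rewrite conn_edge // !inE ?bV ?eqxx ?orbT.
have sV'W : V :|: T' \subset W.
  apply/subsetP => x; rewrite !inE => /orP[->|/orP[/orP[] /eqP->|/andP[_ ->]]];
    by rewrite ?aV ?bV ?orbT.
have notK x : x \in T :\: K -> ~~ conn W v x.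
  by rewrite !inE => /andP[h xT]; move: h; rewrite xT.
have farK x c : x \in T :\: K -> conn W c v -> ~~ conn (V :|: T') c x.
  move=> xTK ccv; apply: contra (notK x xTK) => /(connS sV'W).
  by apply: conn_trans; rewrite conn_sym.
have nabT : ~~ conn (V :|: T') a b.
  apply/negP => cab.
  have : (b \in V) && conn V a b; last by rewrite (negbTE nab) andbF.
  have : (b \in V) && conn V a b || ~~ conn W v b.
    apply: (conn_ind (P := fun z => (z \in V) && conn V a z || ~~ conn W v z) _ cab).
      move=> x y xV' yV' axy /orP[/andP[xV cax]|nvx]; last first.
        apply/orP; right; apply: contra nvx => cvy.
        apply: conn_trans cvy _; rewrite conn_sym.
        by apply: connS sV'W _; apply: conn_edge.
      case: (boolP (y \in V)) => yV /=.
        by rewrite (conn_trans cax (conn_edge xV yV axy)).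
      move: yV'; rewrite 3!inE (negbTE yV) /= => /orP[|yTK]; last exact: notK.
      by rewrite !inE => /orP[] /eqP yE; rewrite yE ?aV ?bV in yV.
    by rewrite aV conn_refl.
  by rewrite [conn W v b]conn_sym cbv orbF.
have sepT' : separated V T'.
  apply/separatedP => x y; rewrite 2![_ \in T']inE.
  have TT z : z \in T :\: K -> z \in T by rewrite inE => /andP[].
  move=> /orP[xab|xT] /orP[yab|yT] nxy.
  - move: xab yab; rewrite !inE => /orP[] /eqP xE /orP[] /eqP yE; subst x y;
      rewrite ?eqxx // in nxy *; by rewrite conn_sym.
  - by apply: farK => //; move: xab; rewrite !inE => /orP[] /eqP->.
  - by rewrite conn_sym; apply: farK => //; move: yab; rewrite !inE => /orP[] /eqP->.
  - by apply: contra (sepT _ _ (TT _ xT) (TT _ yT) nxy); apply: connS sV'W.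
apply: leq_trans (leq_spread sepT').
have nab' : a != b by apply: contraNneq nab => ->; apply: conn_refl.
have disj : [disjoint [set a; b] & T :\: K].
  apply/pred0P => x /=; apply/negbTE/negP => /andP[xab xTK].
  by move: xab (notK x xTK); rewrite !inE => /orP[] /eqP->;
    rewrite conn_sym ?cav ?cbv.
have K1 : #|K| <= 1.
  apply/card_le1P => x; rewrite inE => /andP[xT cvx] y; rewrite !inE.
  apply/idP/eqP => [/andP[yT cvy]|-> ]; last by rewrite xT.
  apply/eqP; apply: contraT => nxy; have := sepT _ _ yT xT nxy.
  by rewrite (conn_trans _ cvx) // conn_sym.
have sKT : K \subset T by apply/subsetP => x; rewrite inE => /andP[].
move: disj; rewrite -leq_card_setU => /eqP->.
rewrite cards2 nab' -(cardsID K T) (setIidPr sKT).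
by rewrite ltn_add2r ltnS.
Qed.

Lemma spread_hit V U :
  U :&: connectors V != set0 -> spread (V :|: U) < spread V.
Proof.
case/set0Pn => v; rewrite inE => /andP[vU vJ].
apply: leq_ltn_trans (spread_connector vJ); apply: spread_anti.
by rewrite setUC; apply: setUS; rewrite sub1set.
Qed.

Lemma spreadU V U : spread (V :|: U) <= spread V.
Proof. by apply: spread_anti; apply: subsetUl. Qed.

Definition undominated V : {set G} := ~: (V :|: nbh V).

(** A largest separated set can be pushed into [V] wherever it touches [N(V)];
    maximality then makes it a transversal of the components of [V], completed
    by a maximal independent set of undominated vertices. *)
Lemma spread_transversal V :
  exists T, [/\ #|T| = spread V, T \subset V :|: undominated V,
    {in T &, forall x y, x != y -> ~~ conn V x y && ~~ adj x y},
    {in V, forall v, exists2 t, t \in T :&: V & conn V v t} &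
    undominated V \subset (T :&: undominated V) :|: nbh (T :&: undominated V)].
Proof.
have [T0 /separatedP sep0 card0] := spread_attained V.
pose push t := if [pick v in V | adj v t] is Some v then
                 if t \in V then t else v else t.
have pushP t : push t = t \/ (push t \in V /\ adj (push t) t).
  rewrite /push; case: pickP => [v /andP[vV avt]|_]; last by left.
  by case: ifP; [left | right].
have pushVQ t : push t \in V :|: undominated V.
  rewrite /push; case: pickP => [v /andP[vV avt]|none].
    by case: ifP => [tV|_]; rewrite inE ?tV ?vV.
  rewrite !inE; case: (boolP (t \in V)) => //= _; apply/existsPn => v.
  by rewrite none.
have cpush t W : V \subset W -> t \in W -> conn W (push t) t.
  move=> /subsetP sVW tW; case: (pushP t) => [->|[pV ap]]; first exact: conn_refl.
  by apply: conn_edge => //; apply: sVW.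
pose T := push @: T0.
have sTW : V :|: T \subset V :|: T0.
  apply/subsetP => x; rewrite !inE => /orP[->//|/imsetP[t tT0 ->]].
  by case: (pushP t) => [->|[->]]; rewrite ?tT0 ?orbT.
have sep0' x y : x \in T0 -> y \in T0 -> x != y -> ~~ conn (V :|: T0) (push x) (push y).
  move=> xT yT nxy; apply: contra (sep0 _ _ xT yT nxy) => cp.
  have cp' t : t \in T0 -> conn (V :|: T0) (push t) t.
    by move=> tT; apply: cpush; rewrite ?subsetUl // inE tT orbT.
  apply: conn_trans (cp' _ yT); apply: conn_trans cp.
  by rewrite conn_sym; apply: cp'.
have sepT : {in T &, forall x y, x != y -> ~~ conn (V :|: T) x y}.
  move=> _ _ /imsetP[x xT ->] /imsetP[y yT ->] npxy.
  have nxy : x != y by apply: contraNneq npxy => ->.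
  by apply: contra (sep0' _ _ xT yT nxy); apply: connS.
have cardT : #|T| = spread V.
  rewrite -card0; apply: card_in_imset => x y xT yT eqp; apply/eqP.
  apply: contraT => nxy; have := sep0' _ _ xT yT nxy.
  by rewrite eqp conn_refl.
have sTVQ : T \subset V :|: undominated V.
  by apply/subsetP => _ /imsetP[t _ ->]; apply: pushVQ.
pose I := T :&: undominated V.
have Qout z v : z \in undominated V -> v \in V -> ~~ adj z v.
  rewrite !inE negb_or => /andP[_ /existsPn nz] vV; apply/negP => azv.
  by have := nz v; rewrite vV adj_sym azv.
have VTI : V :|: T = V :|: I.
  apply/setP => x; rewrite !in_setU in_setI.
  case: (boolP (x \in V)) => //= xV; case: (boolP (x \in T)) => //= xT.
  by move/subsetP/(_ _ xT): sTVQ; rewrite in_setU (negbTE xV).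
have nadjT : {in T &, forall x y, x != y -> ~~ adj x y}.
  move=> x y xT yT nxy; apply: contra (sepT _ _ xT yT nxy).
  by apply: conn_edge; rewrite inE ?xT ?yT orbT.
have nadj x y : x \in T -> y \in T -> ~~ adj x y.
  case: (eqVneq x y) => [->|nxy xT yT]; first by rewrite adj_irr.
  exact: nadjT.
have conn_VT x y : conn (V :|: T) x y -> conn V x y.
  rewrite VTI; apply: conn_isolated => z c; rewrite inE => /andP[zT zQ].
  rewrite 2!inE => /orP[|/andP[cT _]]; first exact: Qout.
  exact: nadj.
exists T; split=> //.
- move=> x y xT yT nxy; rewrite nadjT // andbT.
  by apply: contra (sepT _ _ xT yT nxy); apply: connS; apply: subsetUl.
- move=> v vV; case: (boolP [exists t in T, conn V v t]) => [/exists_inP[t tT cvt]|].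
    by exists t => //; rewrite inE tT (conn_mem cvt vV).
  rewrite negb_exists => /forallP none.
  have vT : v \notin T by have := none v; rewrite conn_refl andbT.
  suff /leq_spread : separated V (v |: T) by rewrite cardsU1 vT cardT ltnn.
  have VvT : V :|: (v |: T) = V :|: T.
    by rewrite setUA [V :|: _]setUC; congr (_ :|: _); apply/setUidPr; rewrite sub1set.
  apply/separatedP => x y; rewrite VvT !in_setU1 => /orP[/eqP->|xT] /orP[/eqP->|yT] nxy.
  + by rewrite eqxx in nxy.
  + by apply: contra (none y) => /conn_VT ->; rewrite yT.
  + by apply: contra (none x) => /conn_VT; rewrite conn_sym => ->; rewrite xT.
  + exact: sepT.
- apply/subsetP => z zQ; apply: contraT; rewrite inE negb_or => /andP[zI zN].
  have zT : z \notin T by apply: contra zI => zT; rewrite inE zT.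
  have zV : z \notin V by move: zQ; rewrite !inE negb_or => /andP[].
  have nzT t : t \in T -> ~~ adj z t.
    move=> tT; case: (boolP (t \in V)) => tV; first exact: Qout.
    apply: contra zN => azt; apply/nbhP; exists t; last by rewrite adj_sym.
    rewrite inE tT; move/subsetP/(_ _ tT): sTVQ; rewrite inE (negbTE tV) //.
  suff /leq_spread : separated V (z |: T) by rewrite cardsU1 zT cardT ltnn.
  have dropz x y : conn (V :|: (z |: T)) x y -> conn (V :|: T) x y.
    rewrite setUCA setUC; apply: conn_isolated => _ c /set1P ->.
    rewrite !inE -orbA => /or3P[|/nzT//|/eqP->]; first exact: Qout.
    by rewrite adj_irr.
  have zfar t : t != z -> ~~ conn (V :|: T) z t.
    move=> ntz; apply/negP => /conn_in; rewrite eq_sym ntz => /(_ isT).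
    by rewrite inE (negbTE zV) (negbTE zT).
  apply/separatedP => x y; rewrite !in_setU1 => /orP[/eqP->|xT] /orP[/eqP->|yT] nxy.
  + by rewrite eqxx in nxy.
  + by apply: contra (zfar y _) => [/dropz//|]; rewrite eq_sym.
  + by apply: contra (zfar x _) => [/dropz|//]; rewrite conn_sym.
  + by apply: contra (sepT _ _ xT yT nxy) => /dropz.
Qed.

End Connectivity.

(** * Cuts read off from a vertex set *)

Section Cuts.
Variable G : sgraph.
Implicit Types (A B I K R S T U V W X Y Z : {set G}) (a b u v w x y z : G).

(** Adding such a vertex [u] to [V] joins no components, but it turns the
    outside neighbour [y] into a connector. *)
Definition borders V : {set G} :=
  [set u | [&& u \notin V, u \notin connectors V &
    [exists a in V, exists b in V, exists y,
      [&& adj a u, adj u y, y \notin V, y \notin connectors V, adj b y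
        & ~~ conn V a b]]]].

Lemma bordersP V u :
  reflect [/\ u \notin V, u \notin connectors V &
    exists a b y, [/\ a \in V, b \in V, adj a u, adj u y &
      [/\ y \notin V, y \notin connectors V, adj b y & ~~ conn V a b]]]
    (u \in borders V).
Proof.
rewrite [u \in borders V]in_set; apply: (iffP and3P).
  case=> uV uJ /exists_inP[a aV /exists_inP[b bV /existsP[y]]].
  by move=> /and5P[au uy yV yJ /andP[b_y nab]]; split=> //; exists a, b, y.
case=> uV uJ [a [b [y [aV bV au uy [yV yJ b_y nab]]]]]; split=> //.
apply/exists_inP; exists a => //; apply/exists_inP; exists b => //.
by apply/existsP; exists y; apply/and5P; split=> //; rewrite b_y.
Qed.

(** Outside [S] every vertex lies in or sees exactly one component of [V], or
    belongs to [I].  Adjacent vertices outside [S] agree in this respect, which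
    makes it a label constant on the components left by [S]. *)
Lemma spread_cut V :
  exists I T, let S := connectors V :|: borders V :|: nbh I in
  [/\ I \subset undominated V, #|I| <= spread V, #|T| = spread V,
      T \subset ~: S & {in T &, forall x y, x != y -> ~~ conn (~: S) x y}].
Proof.
have [T [cardT sTVQ sepT reachT domQ]] := spread_transversal V.
set I := T :&: undominated V in domQ *.
exists I, T => S.
have nsep x y : x \in T -> y \in T -> conn V x y -> x = y.
  move=> xT yT cxy; apply/eqP; apply: contraT => nxy.
  by have /andP[] := sepT _ _ xT yT nxy; rewrite cxy.
have nadj x y : x \in T -> y \in T -> ~~ adj x y.
  move=> xT yT; case: (eqVneq x y) => [->|nxy]; first by rewrite adj_irr.
  by have /andP[] := sepT _ _ xT yT nxy.
have QV z a : z \in undominated V -> a \in V -> ~~ adj a z.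
  rewrite !inE negb_or => /andP[_ /existsPn nz] aV.
  by have := nz a; rewrite aV.
have TNI t : t \in T -> t \notin nbh I.
  move=> tT; apply/nbhP => -[i]; rewrite inE => /andP[iT _].
  by apply/negP; apply: nadj.
pose rep v := odflt v [pick t in T | conn V v t].
have repP v : v \in V -> rep v \in T /\ conn V v (rep v).
  move=> vV; rewrite /rep; case: pickP => [t /andP[]//|none] /=.
  have [t] := reachT v vV; rewrite inE => /andP[tT _] cvt.
  by have := none t; rewrite tT cvt.
have rep_conn u v : u \in V -> v \in V -> conn V u v -> rep u = rep v.
  move=> uV vV cuv; have [ruT cu] := repP u uV; have [rvT cv] := repP v vV.
  apply: nsep => //; apply: conn_trans (conn_trans _ cuv) cv.
  by rewrite conn_sym.
pose label v := if v \in V then rep v else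
                if [pick a in V | adj a v] is Some a then rep a else v.
have label_dom v a : v \notin V -> v \notin connectors V -> a \in V -> adj a v ->
    label v = rep a.
  move=> vV vJ aV av; rewrite /label (negbTE vV).
  case: pickP => [b /andP[bV bv]|none]; last by have := none a; rewrite aV av.
  apply: rep_conn => //; apply: contraT => nba.
  by case/connectorsP: vJ; split=> //; exists b, a.
have labelE u v : u \in ~: S -> v \in ~: S -> adj u v -> label u = label v.
  rewrite inE [u \in S]inE [u \in _ :|: _]inE !negb_or => /andP[/andP[uJ uD] uN].
  rewrite inE [v \in S]inE [v \in _ :|: _]inE !negb_or => /andP[/andP[vJ vD] vN].
  move=> auv.
  wlog uvV : u v auv uJ uD uN vJ vD vN / (v \in V) ==> (u \in V).
    move=> W; case: (boolP (u \in V)) => uV; first by apply: W; rewrite ?uV ?implybT.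
    by symmetry; apply: W; rewrite // 1?adj_sym // (negbTE uV).
  case: (boolP (v \in V)) uvV => /= vV => [uV|_].
    by rewrite /label vV uV; apply: rep_conn => //; apply: conn_edge.
  case: (boolP (u \in V)) => uV.
    by rewrite (label_dom v u) // /label uV.
  have undom w : w \notin V -> w \notin nbh V -> w \notin nbh I -> w \in I.
    move=> wV wN wNI; have : w \in undominated V by rewrite !inE negb_or wV; rewrite inE in wN.
    by move=> /(subsetP domQ); rewrite inE (negbTE wNI) orbF.
  case: (boolP (u \in nbh V)) => [/nbhP[a aV au]|uNV]; last first.
    have uI := undom u uV uNV uN.
    by case/nbhP: vN; exists u.
  case: (boolP (v \in nbh V)) => [/nbhP[b bV bv]|vNV]; last first.
    have vI := undom v vV vNV vN.
    by case/nbhP: uN; exists v; rewrite // adj_sym.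
  rewrite (label_dom u a) // (label_dom v b) //; apply: rep_conn => //.
  apply: contraT => nab; case/bordersP: uD; split=> //.
  by exists a, b, v.
have label_id t : t \in T -> label t = t.
  move=> tT; rewrite /label; case: ifP => tV.
    by have [rT ct] := repP t tV; symmetry; apply: nsep.
  have tQ : t \in undominated V by move/subsetP/(_ _ tT): sTVQ; rewrite inE tV.
  by case: pickP => // a /andP[aV]; rewrite (negbTE (QV _ _ tQ aV)).
split=> //.
- exact: subsetIr.
- by rewrite -cardT; apply: subset_leq_card; apply: subsetIl.
- apply/subsetP => t tT; rewrite inE [t \in S]inE (negbTE (TNI _ tT)) orbF inE negb_or.
  case: (boolP (t \in V)) => tV.
    by rewrite [t \in connectors V]inE [t \in borders V]inE tV.
  have tQ : t \in undominated V by move/subsetP/(_ _ tT): sTVQ; rewrite inE (negbTE tV).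
  apply/andP; split.
    by apply/connectorsP => -[_ [a [b [aV _]]]]; rewrite (negbTE (QV _ _ tQ aV)).
  by apply/bordersP => -[_ _ [a [b [y [aV _]]]]]; rewrite (negbTE (QV _ _ tQ aV)).
- move=> x y xT yT nxy; apply/negP => /(conn_label labelE).
  by rewrite !label_id //; apply/eqP.
Qed.

(** * Unions of components *)

Definition closed_in V R : bool :=
  (R \subset V) && [forall x in R, forall y in V :\: R, ~~ adj x y].

Lemma closed_inP V R :
  reflect (R \subset V /\ {in R & V :\: R, forall x y, ~~ adj x y}) (closed_in V R).
Proof.
apply: (iffP andP) => -[sRV h]; split=> //.
  by move=> x y xR yB; move/forall_inP/(_ x xR)/forall_inP: h; apply.
by apply/forall_inP => x xR; apply/forall_inP => y yB; apply: h.
Qed.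

Lemma closed_conn V R x y : closed_in V R -> conn V x y -> x \in R -> y \in R.
Proof.
move=> /closed_inP[sRV cl]; apply: conn_ind => u v uV vV auv uR.
by apply: contraT => vR; have := cl u v uR; rewrite inE vR vV auv => /(_ isT).
Qed.

(** A union of components is determined by its trace on a transversal of the
    components, and transversals are separated sets. *)
Lemma card_closed V : #|[set R | closed_in V R]| <= 2 ^ spread V.
Proof.
have [T [<- _ _ reachT _]] := spread_transversal V.
rewrite -card_powerset.
have inj : {in [set R | closed_in V R] &, injective (fun R => R :&: T)}.
  suff sub R R' : closed_in V R -> closed_in V R' -> R :&: T = R' :&: T -> R \subset R'.
    move=> R R'; rewrite !inE => cR cR' eqRT.
    by apply/eqP; rewrite eqEsubset (sub R R') // (sub R' R).
  move=> cR cR' /setP eqRT; apply/subsetP => v vR.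
  have vV : v \in V by case/closed_inP: cR => /subsetP/(_ _ vR).
  have [t] := reachT v vV; rewrite inE => /andP[tT _] cvt.
  have tR : t \in R := closed_conn cR cvt vR.
  have := eqRT t; rewrite !inE tT tR !andbT => tR'.
  by apply: (closed_conn cR' _ (esym tR')); rewrite conn_sym.
rewrite -(card_in_imset inj); apply: subset_leq_card.
by apply/subsetP => _ /imsetP[R _ ->]; rewrite inE subsetIr.
Qed.

(** With [R] red and [V :\: R] blue: red borders that do not see blue, with a
    neighbour that sees blue and not red. *)
Definition front V R : {set G} :=
  [set u in nbh R :\: (nbh (V :\: R) :|: V)
     | [exists y in nbh (V :\: R) :\: nbh R, adj u y]].

(** Colour each component red or blue by a fair coin: a border vertex has
    its own component red and that of its witness blue one time in four.  The
    coins are replaced by the flips of these two components. *)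
Lemma front_average V :
  exists2 R, closed_in V R & #|borders V| <= 4 * #|front V R|.
Proof.
pose C := [set R | closed_in V R].
have C0 : set0 \in C.
  by rewrite inE; apply/closed_inP; split; [apply: sub0set|move=> x y; rewrite inE].
have quarter u : u \in borders V -> #|C| <= 4 * #|[set R in C | u \in front V R]|.
  case/bordersP => uV uJ [a [b [y [aV bV au uy [yV yJ b_y nab]]]]].
  pose Ca := [set x | conn V a x]; pose Cb := [set x | conn V b x].
  pose flip R := (R :|: Ca) :\: Cb.
  have clI R : R \in C -> flip R \in C /\ u \in front V (flip R).
    rewrite inE => cR.
    have fE x : (x \in flip R) = ~~ conn V b x && ((x \in R) || conn V a x).
      by rewrite !inE.
    have sRV : R \subset V by case/closed_inP: cR.
    have sfV : flip R \subset V.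
      apply/subsetP => x; rewrite fE => /andP[_ /orP[/(subsetP sRV)//|]].
      by move/conn_mem; apply.
    have cF : closed_in V (flip R).
      apply/closed_inP; split=> // x z; rewrite fE => /andP[nbx xR].
      rewrite inE fE => /andP[nz zV]; apply: contra nz => axz.
      have xV : x \in V.
        by case/orP: xR => [/(subsetP sRV)//|/conn_mem]; apply.
      have cxz : conn V x z by apply: conn_edge.
      apply/andP; split.
        by apply: contra nbx => cbz; apply: conn_trans cbz _; rewrite conn_sym.
      apply/orP; case/orP: xR => [xR|cax]; first by left; apply: closed_conn cxz xR.
      by right; apply: conn_trans cxz.
    have aF : a \in flip R by rewrite fE conn_refl orbT andbT conn_sym.
    have bF : b \in V :\: flip R by rewrite inE bV andbT fE conn_refl.
    have only w c c' : w \notin V -> w \notin connectors V -> c \in V -> c' \in V ->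
        adj c w -> adj c' w -> conn V c c'.
      move=> wV wJ cV c'V cw c'w; apply: contraT => ncc'.
      by case/connectorsP: wJ; split=> //; exists c, c'.
    split; first by rewrite inE.
    rewrite inE in_setD in_setU (negbTE uV) orbF -andbA; apply/and3P; split.
    - apply/nbhP => -[c]; rewrite inE => /andP[cF' cV] cu.
      by case/negP: cF'; apply: (closed_conn cF _ aF); apply: (only u).
    - by apply/nbhP; exists a.
    - apply/exists_inP; exists y => //; rewrite in_setD; apply/andP; split.
        apply/nbhP => -[c cF' cy]; have cV := subsetP sfV _ cF'.
        move: bF; rewrite inE bV andbT => /negP; apply.
        by apply: (closed_conn cF _ cF'); apply: (only y).
      by apply/nbhP; exists b.
  pose h R := (flip R, (a \in R, b \in R)).
  have injh : {in C &, injective h}.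
    suff sub R R' : R \in C -> R' \in C -> h R = h R' -> R \subset R'.
      by move=> R R' RC R'C hR; apply/eqP; rewrite eqEsubset (sub R R') // (sub R' R).
    rewrite !inE => cR cR' [/setP flipE aE bE]; apply/subsetP => x xR.
    case: (boolP (conn V a x)) => cax.
      by apply: (closed_conn cR' cax); rewrite -aE; apply: (closed_conn cR _ xR); rewrite conn_sym.
    case: (boolP (conn V b x)) => cbx.
      by apply: (closed_conn cR' cbx); rewrite -bE; apply: (closed_conn cR _ xR); rewrite conn_sym.
    by have := flipE x; rewrite !inE xR (negbTE cax) (negbTE cbx) /= orbF => <-.
  rewrite -(card_in_imset injh).
  have -> : 4 * #|[set R in C | u \in front V R]| =
      #|setX [set R in C | u \in front V R] [set: bool * bool]|.
    by rewrite cardsX cardsT card_prod card_bool mulnC.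
  apply: subset_leq_card; apply/subsetP => _ /imsetP[R RC ->].
  by have [fC fu] := clI R RC; rewrite in_setX in_setT andbT inE fC.
have [R RC maxR] := arg_maxnP (fun R => #|front V R|) C0.
have {}RC : R \in C by [].
exists R; first by rewrite inE in RC.
have Cpos : 0 < #|C| by apply/card_gt0P; exists set0.
rewrite -(leq_pmul2l Cpos).
have le1 : #|C| * #|borders V| <= \sum_(u in borders V) 4 * #|[set R' in C | u \in front V R']|.
  by rewrite mulnC -sum_nat_const; apply: leq_sum.
apply: leq_trans le1 _; rewrite -big_distrr /= mulnCA leq_pmul2l //.
have cardE (u : G) : #|[set R' in C | u \in front V R']| = \sum_(R' in C) (u \in front V R').
  by rewrite -sum1dep_card big_mkcondr; apply: eq_bigr => R' _; case: ifP.
under eq_bigr do rewrite cardE.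
rewrite exchange_big /= -sum_nat_const; apply: leq_sum => R' R'C.
apply: leq_trans (maxR _ R'C).
rewrite -big_mkcondr /= sum1dep_card; apply: subset_leq_card.
by apply/subsetP => u; rewrite inE => /andP[].
Qed.

End Cuts.

Local Open Scope ring_scope.

(** * Random subsets as product weights *)

Lemma ler_sum_inj (F : numDomainType) (I J : finType) (P : pred I) (Q : pred J)
    (h : I -> J) (f : I -> F) (g : J -> F) :
  {in P &, injective h} -> (forall i, P i -> Q (h i)) ->
  (forall i, P i -> f i <= g (h i)) -> (forall j, Q j -> 0 <= g j) ->
  \sum_(i | P i) f i <= \sum_(j | Q j) g j.
Proof.
move=> injh PQ lefg g0; apply: le_trans (ler_sum _ lefg) _.
rewrite -(big_imset g injh) [leRHS](bigID [in h @: P]) /= addrC.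
rewrite [X in _ <= _ + X](_ : _ = \sum_(j in h @: P) g j).
  by rewrite lerDr; apply: sumr_ge0 => j /andP[Qj _]; apply: g0.
apply: eq_bigl => j; case: imsetP => [[i Pi ->]|]; last by rewrite andbF.
by rewrite PQ.
Qed.

Section Weights.
Variables (F : realFieldType) (T : finType).
Implicit Types (A B D J U V : {set T}) (q r s x : F) (f g : {set T} -> F).

Definition weight q V : F := \prod_v (if v \in V then q else 1 - q).

Definition mean q f : F := \sum_V weight q V * f V.

Lemma sum_prod_sets (a b : T -> F) :
  \sum_(V : {set T}) \prod_v (if v \in V then a v else b v) = \prod_v (a v + b v).
Proof. by rewrite (bigA_distr _ +%R). Qed.

Lemma weight_ge0 q V : 0 <= q <= 1 -> 0 <= weight q V.
Proof.
by case/andP=> q0 q1; apply: prodr_ge0 => v _; case: ifP; rewrite ?subr_ge0.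
Qed.

Lemma sum_weight q : \sum_V weight q V = 1.
Proof. by rewrite sum_prod_sets big1 // => v _; rewrite addrC subrK. Qed.

Lemma mean_cst q (c : F) : mean q (fun=> c) = c.
Proof. by rewrite /mean -mulr_suml sum_weight mul1r. Qed.

Lemma le_mean q f g : 0 <= q <= 1 -> (forall V, f V <= g V) -> mean q f <= mean q g.
Proof. by move=> q01 lefg; apply: ler_sum => V _; rewrite ler_wpM2l ?weight_ge0. Qed.

Lemma meanD q f g : mean q (fun V => f V + g V) = mean q f + mean q g.
Proof. by rewrite -big_split; apply: eq_bigr => V _; rewrite mulrDr. Qed.

Lemma meanZ q (c : F) f : mean q (fun V => c * f V) = c * mean q f.
Proof. by rewrite /mean mulr_sumr; apply: eq_bigr => V _; rewrite mulrCA. Qed.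

(** A set built vertex by vertex from two independent random sets by the same
    rule [op] is again a random set with product weights. *)
Lemma mean_combine (op : bool -> bool -> bool) q r s f :
  s = q * (r * (op true true)%:R + (1 - r) * (op true false)%:R)
    + (1 - q) * (r * (op false true)%:R + (1 - r) * (op false false)%:R) ->
  mean q (fun V => mean r (fun U => f [set v | op (v \in V) (v \in U)])) = mean s f.
Proof.
move=> sE; (* The event that the combined set is [A] factors over the vertices. *)
pose hit b c (d : bool) : F := (op b c == d)%:R.
have indE V U A : ([set v | op (v \in V) (v \in U)] == A)%:R
    = \prod_v hit (v \in V) (v \in U) (v \in A).
  case: (eqVneq [set v | op (v \in V) (v \in U)] A) => [<-|nA].
    by rewrite big1 // => v _; rewrite /hit inE eqxx.
  have [v nv] : exists v, op (v \in V) (v \in U) != (v \in A).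
    apply/existsP; apply: contraNT nA; rewrite negb_exists => /forallP h.
    by apply/eqP/setP => v; rewrite inE; apply/eqP; rewrite -[_ == _]negbK.
  by apply/esym/eqP/prodf_eq0; exists v => //; rewrite /hit (negbTE nv).
have fE V U : f [set v | op (v \in V) (v \in U)]
    = \sum_A f A * \prod_v hit (v \in V) (v \in U) (v \in A).
  rewrite (bigD1 [set v | op (v \in V) (v \in U)]) //= -indE eqxx mulr1.
  by rewrite big1 ?addr0 // => A nA; rewrite -indE eq_sym (negbTE nA) mulr0.
transitivity (\sum_A f A * \sum_V weight q V *
    \sum_U weight r U * \prod_v hit (v \in V) (v \in U) (v \in A)).
  rewrite /mean.
  under eq_bigr => V _ do (under eq_bigr => U _ do rewrite fE mulr_sumr;
    rewrite exchange_big mulr_sumr).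
  rewrite exchange_big; apply: eq_bigr => A _; rewrite mulr_sumr.
  apply: eq_bigr => V _; rewrite [RHS]mulrCA; congr (_ * _); rewrite mulr_sumr.
  by apply: eq_bigr => U _; rewrite mulrCA.
apply: eq_bigr => A _; rewrite mulrC; congr (_ * _).
transitivity (\sum_(V : {set T}) \prod_v (if v \in V
    then q * (r * hit true true (v \in A) + (1 - r) * hit true false (v \in A))
    else (1 - q) * (r * hit false true (v \in A) + (1 - r) * hit false false (v \in A)))).
  apply: eq_bigr => V _.
  transitivity (weight q V * \prod_v (r * hit (v \in V) true (v \in A)
      + (1 - r) * hit (v \in V) false (v \in A))).
    congr (_ * _); rewrite -sum_prod_sets; apply: eq_bigr => U _.
    by rewrite -big_split; apply: eq_bigr => v _ /=; case: (v \in U).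
  by rewrite -big_split; apply: eq_bigr => v _ /=; case: (v \in V).
rewrite sum_prod_sets; apply: eq_bigr => v _; rewrite sE /hit.
by case: (v \in A); case: (op true true); case: (op true false);
  case: (op false true); case: (op false false); rewrite /=; ring.
Qed.

Lemma mean_setU q r f :
  mean q (fun V => mean r (fun U => f (V :|: U))) = mean (1 - (1 - q) * (1 - r)) f.
Proof. by apply: (mean_combine (op := orb)); rewrite /=; ring. Qed.

Lemma mean_setI q r f :
  mean q (fun V => mean r (fun U => f (V :&: U))) = mean (q * r) f.
Proof. by apply: (mean_combine (op := andb)); rewrite /=; ring. Qed.

Lemma mean_disjoint q J : mean q (fun V => [disjoint V & J]%:R) = (1 - q) ^+ #|J|.
Proof.
transitivity (\sum_(V : {set T}) \prod_v (if v \in V then q * (v \notin J)%:R else 1 - q)).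
  apply: eq_bigr => V _; case: (boolP [disjoint V & J]) => [dVJ|].
    rewrite mulr1; apply: eq_bigr => v _; case: ifP => // vV.
    by rewrite (disjointFr dVJ vV) mulr1.
  rewrite disjoint_subset => /subsetPn[v vV]; rewrite inE negbK => vJ.
  rewrite mulr0; apply/esym/eqP/prodf_eq0; exists v => //.
  by rewrite vV vJ mulr0.
rewrite sum_prod_sets -prodr_const [RHS]big_mkcond; apply: eq_bigr => v _.
by case: (v \in J) => /=; ring.
Qed.

Lemma sum_expr_card x : \sum_(V : {set T}) x ^+ #|V| = (1 + x) ^+ #|T|.
Proof.
transitivity (\sum_(V : {set T}) \prod_v (if v \in V then x else 1)).
  by apply: eq_bigr => V _; rewrite -big_mkcond prodr_const.
rewrite sum_prod_sets (eq_bigr (fun=> 1 + x)) ?prodr_const // => v _.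
by rewrite addrC.
Qed.

(** A vertex of [D] contributes [x * q + (1 - q)] to the right-hand side and
    [(1 - q) * (1 + x * q)], which is smaller by [x * q ^+ 2], to the left. *)
Lemma weight_enlarge q x V D : 0 <= q <= 1 -> 0 <= x -> [disjoint V & D] ->
  weight q V * (1 + x * q) ^+ #|D| <=
    \sum_(U : {set T} | U \subset D) weight q (V :|: U) * x ^+ #|U|.
Proof.
move=> q01 x0 dVD; have /andP[q0 q1] := q01.
have -> : \sum_(U : {set T} | U \subset D) weight q (V :|: U) * x ^+ #|U| =
    \sum_(U : {set T}) \prod_v (if v \in U then q * x * (v \in D)%:R
      else if v \in V then q else 1 - q).
  rewrite big_mkcond; apply: eq_bigr => U _; case: ifP => [sUD|/negbT/subsetPn[v vU vD]].
    rewrite -prodr_const [X in _ * X]big_mkcond -big_split /=.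
    apply: eq_bigr => v _; rewrite inE orbC; case: (boolP (v \in U)) => vU /=.
      by rewrite (subsetP sUD) // mulr1.
    by rewrite mulr1.
  by apply/esym/eqP/prodf_eq0; exists v => //; rewrite vU (negbTE vD) mulr0.
rewrite sum_prod_sets -prodr_const [X in _ * X]big_mkcond -big_split /=.
apply: ler_prod => v _; case: (boolP (v \in V)) => vV.
  by rewrite (disjointFr dVD vV) !mulr1 mulr0 add0r q0 lexx.
case: (v \in D); rewrite ?mulr1 ?mulr0 ?add0r ?subr_ge0 ?q1 ?lexx //.
apply/andP; split; first by apply: mulr_ge0; rewrite ?subr_ge0 // addr_ge0 ?mulr_ge0 ?ler01.
have : 0 <= x * (q * q) by rewrite !mulr_ge0.
lra.
Qed.

End Weights.

(** * Switching *)

Section Switching.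
Variables (F : realFieldType) (G : sgraph).
Implicit Types (I R U V X Y : {set G}) (q z c : F).
Let h : F := 2^-1.

Lemma half_ge0 : 0 <= h. Proof. by rewrite invr_ge0 ler0n. Qed.
Lemma half_le1 : h <= 1. Proof. by rewrite invf_le1 ?ler1n ?ltr0n. Qed.

Lemma half_exp_le m n : (m <= n)%N -> h ^+ n <= h ^+ m.
Proof. exact: (ler_wiXn2l half_ge0 half_le1). Qed.

(** Each vertex of [U] has a neighbour in [Y] shared with no vertex of
    [X :\: U]; then [U] is determined by the neighbours of [X :\: U] in [Y]. *)
Definition witnessed X Y U : bool :=
  (U \subset X) && (U \subset nbh (Y :\: nbh (X :\: U))).

(** A Kraft inequality: decide the vertices of [X] one after the other.  A
    vertex that still has a neighbour in [Y] costs one halving whether it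
    enters [U] or, then using up at least one vertex of [Y], stays outside;
    a vertex without a neighbour left in [Y] cannot enter [U]. *)
Lemma kraft X Y :
  \sum_(U | witnessed X Y U) h ^+ (#|U| + #|Y :&: nbh (X :\: U)|) <= 1.
Proof.
have [n] := ubnP #|X|; elim: n X Y => // n IHn X Y leXn.
case: (set_0Vmem X) => [X0|[x xX]].
  rewrite (eq_bigl (pred1 set0)) ?big_pred1_eq ?cards0 ?exprn_ile1 ?half_ge0 ?half_le1 //.
  move=> U; rewrite /witnessed X0 subset0 /=; case: eqP => // ->.
  by rewrite sub0set.
pose X' := X :\ x.
have ltX'n : (#|X'| < n)%N by rewrite (cardsD1 x) xX in leXn.
have nbhX' U : nbh (X' :\: U) \subset nbh (X :\: U).
  by apply: nbhS; rewrite setSD // subD1set.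
have keepx U : x \notin U -> U \subset X -> U \subset X'.
  by move=> xU sUX; rewrite subsetD1 sUX xU.
case: (boolP [exists y in Y, adj x y]) => [/exists_inP[y0 y0Y axy0]|noY]; last first.
  apply: le_trans (IHn X' Y ltX'n).
  apply: (@ler_sum_inj _ _ _ _ _ id) => //.
  - move=> U /andP[sUX sUN]; rewrite /witnessed keepx //=.
      by apply: subset_trans sUN _; apply: nbhS; apply: setDS.
    apply: contra noY => /(subsetP sUN)/nbhP[y]; rewrite inE => /andP[_ yY] ayx.
    by apply/exists_inP; exists y; rewrite // adj_sym.
  - move=> U _; apply: half_exp_le; rewrite leq_add2l subset_leq_card //.
    exact: setIS.
  - by move=> U _; rewrite exprn_ge0 ?half_ge0.
have -> : 1 = h * 1 + h * 1 :> F by rewrite /h; field.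
rewrite (bigID (fun U => x \in U)) /=; apply: lerD.
  apply: le_trans (ler_wpM2l half_ge0 (IHn X' Y ltX'n)); rewrite mulr_sumr.
  have XU U : x \in U -> X' :\: (U :\ x) = X :\: U.
    move=> xU; apply/setP => v; rewrite !inE negb_and negbK.
    by case: (eqVneq v x) => //= ->; rewrite xU.
  apply: (@ler_sum_inj _ _ _ _ _ (fun U => U :\ x)).
  - move=> U U' /andP[_ xU] /andP[_ xU'] eqU.
    by rewrite -(setD1K xU) eqU setD1K.
  - move=> U /andP[/andP[sUX sUN] xU]; rewrite /witnessed XU // setSD //=.
    by apply: subset_trans sUN; apply: subD1set.
  - move=> U /andP[_ xU]; rewrite XU // -exprS; apply: half_exp_le.
    by rewrite -addSn [#|U|](cardsD1 x) xU.
  - by move=> U _; rewrite mulr_ge0 ?exprn_ge0 ?half_ge0.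
pose Nx := nbh [set x].
have inNx y : (y \in Nx) = adj x y.
  by apply/nbhP/idP => [[_ /set1P ->]//|]; exists x; rewrite ?set11.
apply: le_trans (ler_wpM2l half_ge0 (IHn X' (Y :\: Nx) ltX'n)); rewrite mulr_sumr.
have nbhXU U : x \notin U -> nbh (X :\: U) = Nx :|: nbh (X' :\: U).
  move=> xU; apply/setP => y; rewrite in_setU inNx; apply/nbhP/orP.
    move=> [v]; rewrite inE => /andP[vU vX] avy.
    case: (eqVneq v x) => [<-|nvx]; first by left.
    by right; apply/nbhP; exists v; rewrite // !inE vU nvx.
  case=> [axy|/nbhP[v]]; first by exists x; rewrite // inE xU.
  by rewrite !inE => /and3P[vU _ vX] avy; exists v; rewrite // inE vU.
apply: (@ler_sum_inj _ _ _ _ _ id) => //.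
- move=> U /andP[/andP[sUX sUN] xU]; rewrite /witnessed keepx //=.
  by rewrite setDDl -nbhXU.
- move=> U /andP[_ xU]; rewrite -exprS; apply: half_exp_le.
  rewrite -addnS leq_add2l nbhXU //.
  apply: (@leq_trans #|y0 |: ((Y :\: Nx) :&: nbh (X' :\: U))|).
    by rewrite cardsU1 in_setI in_setD inNx axy0.
  apply: subset_leq_card; apply/subsetP => y.
  rewrite in_setU1 !in_setI in_setD in_setU => /orP[/eqP->|/andP[/andP[_ ->] ->]].
    by rewrite y0Y inNx axy0.
  by rewrite orbT.
- by move=> U _; rewrite mulr_ge0 ?exprn_ge0 ?half_ge0.
Qed.

(** Switching: each exceptional [V] is spread over the sets [V :|: U] with [U]
    in the front of [R V].  The front consists of neighbours of the red part,
    so red and blue stay unconnected and [U] is recovered, by the Kraft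
    inequality, at the cost of the connectors only. *)
Lemma switching q (P : pred {set G}) (R : {set G} -> {set G}) :
  0 <= q <= 1 -> (forall V, P V -> closed_in V (R V)) ->
  \sum_(V | P V) weight q V * (h ^+ spread V *
     h ^+ #|nbh (R V) :&: nbh (V :\: R V)| * (1 + h * q) ^+ #|front V (R V)|) <= 1.
Proof.
move=> q01 clR.
pose D V := front V (R V); pose B V := V :\: R V.
have DP V u : u \in D V -> [/\ u \notin V, u \in nbh (R V), u \notin nbh (B V) &
    u \in nbh (nbh (B V) :\: nbh (R V))].
  rewrite inE in_setD in_setU negb_or => /andP[/andP[/andP[uB uV] uR] /exists_inP[y yN auy]].
  by split=> //; apply/nbhP; exists y; rewrite // adj_sym.
(* The weight of [V :|: U], with the price of recovering [U] from it. *)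
pose g V U := weight q (V :|: U) * h ^+ spread (V :|: U) *
  h ^+ (#|U| + #|nbh (B V) :&: nbh (R V)|).
apply: (@le_trans _ _ (\sum_(V | P V) \sum_(U : {set G} | U \subset D V) g V U)).
  apply: ler_sum => V PV; rewrite mulrCA.
  have dVD : [disjoint V & D V].
    rewrite disjoint_sym disjoint_subset; apply/subsetP => u /DP[uV _ _ _].
    by rewrite inE.
  apply: le_trans (ler_wpM2l _ (weight_enlarge q01 half_ge0 dVD)) _.
    by rewrite mulr_ge0 ?exprn_ge0 ?half_ge0.
  rewrite mulr_sumr; apply: ler_sum => U sUD; rewrite /g exprD setIC.
  rewrite -/(B V) mulrCA -!mulrA ler_wpM2l ?weight_ge0 //.
  rewrite [leLHS]mulrCA [leLHS]mulrC -!mulrA ler_wpM2r //.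
  + by rewrite mulr_ge0 ?exprn_ge0 ?half_ge0.
  + by rewrite half_exp_le ?spreadU.
(* Triples of the enlarged set, its red part, and [U] inside the red part. *)
pose W := ({set G} * ({set G} * {set G}))%type.
pose ok (w : W) := closed_in w.1 w.2.1 &&
  witnessed w.2.1 (nbh (w.1 :\: w.2.1)) w.2.2.
pose gw (w : W) := weight q w.1 * h ^+ spread w.1 *
  h ^+ (#|w.2.2| + #|nbh (w.1 :\: w.2.1) :&: nbh (w.2.1 :\: w.2.2)|).
have gw0 w : 0 <= gw w by rewrite !mulr_ge0 ?exprn_ge0 ?half_ge0 ?weight_ge0.
rewrite pair_big_dep /=.
apply: (@le_trans _ _ (\sum_(w | ok w) gw w)).
  pose enl (w : {set G} * {set G}) : W := (w.1 :|: w.2, (R w.1 :|: w.2, w.2)).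
  have disjVU V U : U \subset D V -> V :&: U = set0.
    move=> sUD; apply/setP => v; rewrite !inE; apply/negP => /andP[vV vU].
    by have [] := DP _ _ (subsetP sUD _ vU); rewrite vV.
  have disjRU V U : P V -> U \subset D V -> R V :&: U = set0.
    move=> PV sUD; apply/eqP; rewrite -subset0 -(disjVU _ _ sUD) setSI //.
    by case/closed_inP: (clR V PV).
  have BE V U : P V -> U \subset D V -> (V :|: U) :\: (R V :|: U) = B V.
    move=> PV sUD; apply/setP => v; rewrite !inE negb_or.
    case: (boolP (v \in U)) => vU; rewrite ?andbF ?andbT ?orbF //=.
    by have [/negbTE-> _ _ _] := DP _ _ (subsetP sUD _ vU); rewrite andbF.
  have cancelU A U : A :&: U = set0 -> (A :|: U) :\: U = A.
    move=> AU; rewrite setDUl setDv setU0; apply/setDidPl.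
    by rewrite -setI_eq0 AU.
  apply: (@ler_sum_inj _ _ _ _ _ enl).
  - move=> [V U] [V' U'] /andP[/= PV sUD] /andP[/= PV' sUD'] [eqV _ eqU].
    congr pair => //.
    by rewrite -(cancelU V U (disjVU _ _ sUD)) eqV eqU cancelU // disjVU.
  - move=> [V U] /andP[/= PV sUD]; rewrite /ok /= BE //.
    have [sRV cl] := closed_inP _ _ (clR V PV).
    apply/andP; split.
      apply/closed_inP; rewrite BE //; split; first exact: setSU.
      move=> x y; rewrite inE => /orP[xR|xU] yB; first exact: cl.
      have [_ _ xB _] := DP _ _ (subsetP sUD _ xU).
      by apply: contra xB => axy; apply/nbhP; exists y; rewrite // adj_sym.
    rewrite /witnessed subsetUr /= cancelU ?disjRU //.
    by apply/subsetP => u uU; have [] := DP _ _ (subsetP sUD _ uU).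
  - move=> [V U] /andP[/= PV sUD]; rewrite /gw /= BE // cancelU ?disjRU //.
  - by move=> w _; apply: gw0.
have -> : \sum_(w | ok w) gw w = \sum_V \sum_(X | closed_in V X)
    \sum_(U | witnessed X (nbh (V :\: X)) U) gw (V, (X, U)).
  rewrite (eq_bigr _ (fun V _ => pair_big_dep _ _ _)) pair_big_dep /=.
  by apply: eq_big => [[V [X U]]|[V [X U]] _].
rewrite -[leRHS](sum_weight G q); apply: ler_sum => V _.
apply: (@le_trans _ _ (\sum_(X | closed_in V X) weight q V * h ^+ spread V)).
  apply: ler_sum => X _; rewrite /gw /= -mulr_sumr -[leRHS]mulr1.
  by rewrite ler_wpM2l ?kraft // mulr_ge0 ?exprn_ge0 ?half_ge0 ?weight_ge0.
rewrite sumr_const -mulr_natr -mulrA -[leRHS]mulr1 ler_wpM2l ?weight_ge0 //.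
rewrite exprVn mulrC ler_pdivrMr ?exprn_gt0 ?ltr0n // mul1r -natrX ler_nat.
by rewrite -cardsE; apply: card_closed.
Qed.

(** A vertex of [nbh I] is missed with probability [1 - q], which pays for the
    factor [c]; what is left is the sum of [z ^+ #|I|] over all [I]. *)
Lemma missed_nbh q z c : 0 <= q <= 1 -> 0 <= z -> 0 <= c -> c * (1 - q) <= 1 ->
  \sum_(V : {set G}) weight q V *
      (\sum_(I : {set G} | [disjoint V & nbh I]) z ^+ #|I| * c ^+ #|nbh I|)
    <= (1 + z) ^+ #|G|.
Proof.
move=> /andP[q0 q1] z0 c0 cq; rewrite -sum_expr_card.
under eq_bigr do rewrite big_mkcond mulr_sumr.
rewrite exchange_big; apply: ler_sum => I _.
rewrite (eq_bigr (fun V : {set G} => z ^+ #|I| * c ^+ #|nbh I| *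
    (weight q V * [disjoint V & nbh I]%:R))); last first.
  by move=> V _; case: ifP => _; rewrite ?mulr1 ?mulr0 // mulrC.
rewrite -mulr_sumr -/(mean q (fun V : {set G} => [disjoint V & nbh I]%:R)) mean_disjoint.
rewrite -mulrA -exprMn ler_piMr ?exprn_ge0 // exprn_ile1 //.
by rewrite mulr_ge0 ?subr_ge0.
Qed.

End Switching.

(** * Toughness and separated sets *)

Lemma conn_setT (H : sgraph) (x y : H) : connect (@adj H) x y = conn [set: H] x y.
Proof. by apply: eq_connect => u v; rewrite withinE !in_setT. Qed.

Lemma conn_induced (G : sgraph) (V : {set G}) (B : {set induced_subgraph V})
    (x y : induced_subgraph V) :
  conn (val @: B) (val x) (val y) = conn B x y.
Proof.
apply/idP/idP => [cxy|].
  pose P v := [exists z : induced_subgraph V, (val z == v) && conn B x z].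
  suff /existsP[z /andP[/eqP/val_inj <-]] : P (val y) by [].
  apply: (conn_ind (P := P) _ cxy).
    move=> _ _ /imsetP[u uB ->] /imsetP[v vB ->] auv.
    case/existsP => z /andP[/eqP/val_inj -> cxu].
    apply/existsP; exists v; rewrite eqxx /=; apply: conn_trans cxu _.
    exact: conn_edge.
  by apply/existsP; exists x; rewrite eqxx conn_refl.
move=> cxy; apply: (conn_ind (G := induced_subgraph V)
  (P := fun z : induced_subgraph V => conn (val @: B) (val x) (val z)) _ cxy).
  move=> u v uB vB auv cxu; apply: conn_trans cxu _.
  by apply: conn_edge; rewrite ?imset_f.
exact: conn_refl.
Qed.

Lemma conn_adj_sym (H : sgraph) : connect_sym (@adj H).
Proof. by apply: sym_connect_sym; apply: adj_sym. Qed.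

Lemma num_components_witness (H : sgraph) :
  exists2 T : {set H}, #|T| = num_components H &
    {in T &, forall x y, x != y -> ~~ conn [set: H] x y}.
Proof.
exists [set x | roots (@adj H) x].
  rewrite cardsE; apply: eq_card => x.
  by rewrite !inE andbT.
move=> x y; rewrite !inE => /eqP rx /eqP ry nxy; rewrite -conn_setT.
by rewrite -(root_connect (@conn_adj_sym H)) rx ry.
Qed.

Lemma leq_num_components (H : sgraph) (T : {set H}) :
  {in T &, forall x y, x != y -> ~~ conn [set: H] x y} -> (#|T| <= num_components H)%N.
Proof.
move=> sep; have inj : {in T &, injective (fingraph.root (@adj H))}.
  move=> x y xT yT /eqP; rewrite (root_connect (@conn_adj_sym H)) conn_setT => cxy.
  by apply/eqP; apply: contraT => /(sep _ _ xT yT); rewrite cxy.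
rewrite -(card_in_imset inj); apply: subset_leq_card; apply/subsetP => _ /imsetP[x _ ->].
by rewrite !inE andbT; apply: roots_root; apply: conn_adj_sym.
Qed.

Lemma val_setT (G : sgraph) (V : {set G}) : val @: [set: induced_subgraph V] = V.
Proof.
apply/setP => v; apply/imsetP/idP => [[x _ ->]|vV]; first exact: valP.
by exists (exist _ v vV).
Qed.

Lemma tough_separated (R : realType) (t : R) (G : sgraph) (S T : {set G}) :
  0 <= t -> tough t G -> T \subset ~: S ->
  {in T &, forall x y, x != y -> ~~ conn (~: S) x y} -> (2 <= #|T|)%N ->
  t * #|T|%:R <= #|S|%:R.
Proof.
move=> t0 tG sTS sep T2; pose H := del_vertices S.
have leT : (#|T| <= num_components H)%N.
  pose T' : {set H} := [set x | val x \in T].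
  have TE : T = val @: T'.
    apply/setP => v; apply/idP/imsetP => [vT|[x]]; last by rewrite inE => xT ->.
    by exists (exist _ v (subsetP sTS _ vT)); rewrite ?inE.
  rewrite TE card_imset; last exact: val_inj.
  apply: leq_num_components => x y; rewrite !inE => xT yT nxy.
  rewrite -conn_induced val_setT; apply: sep => //.
apply: le_trans (tG S (leq_trans T2 leT)).
by rewrite ler_wpM2l // ler_nat.
Qed.

(** One vertex from each component left by a violating set makes a separated
    set, so the failure of toughness is visible in [G] itself. *)
Lemma not_tough_spread (R : realType) (s : R) (G : sgraph) (V : {set G}) :
  ~ tough s (induced_subgraph V) ->
  exists (S : {set G}) (k : nat),
    [/\ (2 <= k)%N, (k <= spread (V :\: S))%N & #|S|%:R < s * k%:R].
Proof.
move=> ntough; pose H := induced_subgraph V.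
have [S] : exists S : {set H}, (2 <= num_components (del_vertices S))%N &&
    (#|S|%:R < s * (num_components (del_vertices S))%:R).
  apply/existsP; apply: contraT => none; exfalso; apply: ntough => S k2.
  by move/existsPn/(_ S): none; rewrite k2 /= -leNgt.
case/andP => k2 ltS.
exists (val @: S), (num_components (del_vertices S)); split=> //; last first.
  by rewrite card_imset //; apply: val_inj.
have [T0 <- sep0] := num_components_witness (del_vertices S).
pose T1 : {set H} := val @: T0; pose T := val @: T1.
have -> : #|T0| = #|T| by rewrite !card_imset //; apply: val_inj.
have VS : V :\: val @: S = val @: (~: S).
  apply/setP => v; rewrite inE; apply/andP/imsetP => [[vS vV]|[x xS ->]].
    exists (exist _ v vV) => //; rewrite inE; apply: contra vS => vS.
    by apply/imsetP; exists (exist _ v vV).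
  split; last exact: valP.
  by rewrite mem_imset ?inE in xS *; last exact: val_inj.
have sT1 : T1 \subset ~: S by apply/subsetP => _ /imsetP[x _ ->]; apply: valP.
apply: leq_spread; apply/separatedP => _ _ /imsetP[_ /imsetP[x xT ->] ->]
  /imsetP[_ /imsetP[y yT ->] ->] nxy.
have -> : (V :\: val @: S) :|: T = val @: (~: S).
  by rewrite VS; apply/setUidPl; apply: imsetS.
rewrite conn_induced -[X in conn X](val_setT (~: S)) conn_induced.
by apply: sep0 => //; apply: contraNneq nxy => ->.
Qed.

(** The sizes of the three parts of the cut of [spread_cut]. *)
Lemma tough_spread_cut (R : realType) (t : R) (G : sgraph) (V : {set G}) :
  0 <= t -> tough t G -> (2 <= spread V)%N ->
  exists I : {set G}, [/\ [disjoint V & nbh I], (#|I| <= spread V)%N &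
    t * (spread V)%:R <= #|connectors V|%:R + #|borders V|%:R + #|nbh I|%:R].
Proof.
move=> t0 tG k2; have [I [T [sIQ leI cardT sTS sep]]] := spread_cut V.
exists I; split=> //.
  rewrite disjoint_sym disjoint_subset; apply/subsetP => y /nbhP[x xI axy].
  rewrite inE; apply/negP => yV; have := subsetP sIQ x xI.
  rewrite !inE negb_or => /andP[_ /existsPn/(_ y)].
  by rewrite yV adj_sym axy.
rewrite -cardT in k2 *; apply: le_trans (tough_separated t0 tG sTS sep k2) _.
rewrite -!natrD ler_nat; apply: leq_trans (leq_card_setU _ _) _.
by rewrite leq_add2r; apply: leq_card_setU.
Qed.

(** Deleting all other vertices leaves two components. *)
Lemma tough_le_card (R : realType) (t : R) (G : sgraph) (x y : G) :
  0 <= t -> tough t G -> x != y -> ~~ adj x y -> t <= #|G|%:R.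
Proof.
move=> t0 tG nxy naxy; set T := [set x; y].
have nadj u v : u \in T -> v \in T -> ~~ adj u v.
  by rewrite !inE => /orP[] /eqP -> /orP[] /eqP ->; rewrite ?adj_irr // adj_sym.
have T2 : #|T| = 2%N by rewrite cards2 nxy.
have : t * #|T|%:R <= #|~: T|%:R.
  apply: tough_separated; rewrite ?setCK ?T2 // => u v uT vT nuv.
  apply/negP => cuv; have : u == v; last by rewrite (negbTE nuv).
  rewrite eq_sym; apply: (conn_ind (P := fun z => z == u) _ cuv) => // a b aT bT aab _.
  by case/negP: (nadj a b aT bT).
rewrite T2 => le2; apply: le_trans (le_trans _ le2) _.
  by rewrite ler_peMr // ler1n.
by rewrite ler_nat max_card.
Qed.

Lemma spread_complete (G : sgraph) (V : {set G}) :
  (forall x y : G, x != y -> adj x y) -> (spread V <= 1)%N.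
Proof.
move=> complete; have [T /separatedP sepT <-] := spread_attained V.
apply/card_le1P => x xT y; rewrite !inE; apply/idP/eqP => [yT|->//].
apply/eqP; apply: contraT => nyx; have := sepT _ _ yT xT nyx.
by rewrite conn_edge ?complete // inE ?xT ?yT orbT.
Qed.

Lemma nbh_closed_connectors (G : sgraph) (V R : {set G}) :
  closed_in V R -> nbh R :&: nbh (V :\: R) \subset connectors V.
Proof.
move=> cR; have [sRV cl] := closed_inP _ _ cR.
apply/subsetP => v; rewrite inE => /andP[/nbhP[a aR av] /nbhP[b bB bv]].
have [bR bV] : b \notin R /\ b \in V by move: bB; rewrite inE => /andP.
apply/connectorsP; split.
  apply/negP => vV; case: (boolP (v \in R)) => vR.
    by have := cl v b vR bB; rewrite adj_sym bv.
  by have := cl a v aR; rewrite inE vR vV av => /(_ isT).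
exists a, b; split=> //; first exact: (subsetP sRV).
by apply: contra bR => cab; apply: closed_conn cR cab aR.
Qed.

(** * Elementary estimates *)

Section Estimates.
Variable R : realType.
Implicit Types (a s u x y d : R) (m n : nat).

Lemma expRN_le u : 0 <= u <= 1 -> expR (- u) <= 1 - u / 2.
Proof.
move=> /andP[u0 u1]; rewrite expRN -[leLHS]div1r ler_pdivrMr ?expR_gt0 //.
apply: (@le_trans _ _ ((1 - u / 2) * (1 + u))); first by nra.
by rewrite ler_wpM2l ?expR_ge1Dx //; lra.
Qed.

Lemma expR_half_le u : 0 <= u <= 1 -> expR (u / 2) <= 1 + u.
Proof.
move=> /andP[u0 u1]; have p0 : 0 < 1 - u / 2 by lra.
rewrite -(ler_pM2r p0); apply: (@le_trans _ _ 1); last by nra.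
apply: (@le_trans _ _ (expR (u / 2) * expR (- (u / 2)))).
  by rewrite ler_wpM2l ?expR_ge0 ?expR_ge1Dx.
by rewrite -expRD subrr expR0.
Qed.

Lemma bernoulli s m : 0 <= s <= 1 -> 1 - m%:R * s <= (1 - s) ^+ m.
Proof.
move=> /andP[s0 s1]; elim: m => [|m IHm]; first by rewrite mul0r subr0 expr0.
rewrite exprS; apply: le_trans (ler_wpM2l _ IHm); last by lra.
have m0 : 0 <= m%:R :> R by rewrite ler0n.
by rewrite -natr1; nra.
Qed.

Lemma expr_tangent x y m : 0 < x -> 0 <= y <= x ->
  x ^+ m * (x - m.+1%:R * y) <= (x - y) ^+ m.+1.
Proof.
move=> x0 /andP[y0 yx].
have s01 : 0 <= y / x <= 1 by rewrite divr_ge0 ?(ltW x0) //= ler_pdivrMr ?mul1r.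
have -> : x - y = x * (1 - y / x) by field; lra.
rewrite exprMn (exprSr x) -mulrA ler_wpM2l ?exprn_ge0 ?(ltW x0) //.
have -> : x - m.+1%:R * y = x * (1 - m.+1%:R * (y / x)) by field; lra.
by rewrite ler_wpM2l ?(ltW x0) ?bernoulli.
Qed.

Lemma expr_miss d n : 0 <= d <= 1 -> n%:R * d <= 1 -> (1 - d) ^+ n <= 1 - n%:R * d / 2.
Proof.
move=> /andP[d0 d1] nd1.
apply: (@le_trans _ _ (expR (- d) ^+ n)).
  by apply: lerXn2r; rewrite ?nnegrE ?expR_ge0 ?expR_ge1Dx //; lra.
rewrite -expRM_natl mulrN; apply: expRN_le; rewrite nd1 andbT.
by rewrite mulr_ge0.
Qed.

Lemma two_le_expR1 : 2 <= expR (1 : R).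
Proof. by have := expR_ge1Dx (1 : R); lra. Qed.

Lemma half_in01 : 0 <= (2^-1 : R) <= 1.
Proof. by apply/andP; split; lra. Qed.

Lemma expRN_le_half n : expR (- n%:R) <= 2^-1 ^+ n :> R.
Proof.
rewrite -[n%:R]mulr1 -mulrN expRM_natl lerXn2r ?nnegrE ?expR_ge0 ?invr_ge0 //.
by rewrite expRN lef_pV2 ?posrE ?expR_gt0 ?two_le_expR1.
Qed.

Lemma expr_1Dn n : (1 + n%:R^-1) ^+ n <= expR (1 : R).
Proof.
case: n => [|n]; first by rewrite expr0; have := two_le_expR1; lra.
apply: (@le_trans _ _ (expR (n.+1%:R^-1) ^+ n.+1)).
  by apply: lerXn2r; rewrite ?nnegrE ?expR_ge0 ?expR_ge1Dx // addr_ge0 ?invr_ge0.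
by rewrite -expRM_natl mulfV ?pnatr_eq0.
Qed.

Lemma expR_lnn n : (0 < n)%N -> expR (ln (n%:R : R)) = n%:R.
Proof. by move=> n0; rewrite lnK // posrE ltr0n. Qed.

Lemma border_exponent (p t k j f : R) : 0 <= p -> 1 <= k -> 2 ^+ 8 <= p * t ->
    j <= p * t * k / 2 ^+ 7 -> t * k / 8 <= f ->
  p * t * k / 2 ^+ 8 <= - k - j + p / 8 * f.
Proof.
move=> p0 k1 a256 lej lef; have k0 : 0 <= k := le_trans ler01 k1.
have h1 : p / 8 * (t * k / 8) <= p / 8 * f by rewrite ler_wpM2l ?divr_ge0.
have h2 : 2 ^+ 8 * k <= p * t * k by rewrite ler_wpM2r.
lra.
Qed.

Lemma nbh_exponent (p t k i N l : R) : 0 <= p <= 1 -> 0 <= t -> 0 <= k -> 0 <= l ->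
    i <= k -> t * k / 4 <= N -> 16 * l <= p * t ->
  p * t * k / 2 ^+ 8 <= - l * i + p / 2 * N.
Proof.
move=> /andP[p0 p1] t0 k0 l0 leik leN la.
have h1 : p / 2 * (t * k / 4) <= p / 2 * N by rewrite ler_wpM2l ?divr_ge0.
have h2 : l * i <= l * k by rewrite ler_wpM2l.
have h3 : 16 * l * k <= p * t * k by rewrite ler_wpM2r.
have h4 : 0 <= p * t * k by rewrite !mulr_ge0.
lra.
Qed.

Lemma nbh_share (p t k J B N : R) : 0 <= p <= 1 -> 0 <= t -> 0 <= k ->
  t * k <= J + B + N -> J <= p * t * k / 2 ^+ 7 -> B <= t * k / 2 -> t * k / 4 <= N.
Proof.
move=> /andP[p0 p1] t0 k0 cut leJ leB.
have h1 : p * t * k <= t * k by rewrite ler_wpM2r // ler_piMl.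
have h2 : 0 <= t * k by rewrite mulr_ge0.
lra.
Qed.

Lemma rich_rate (a d eta J m : R) : 0 <= a -> 0 <= d -> 0 <= m ->
    eta <= d * a / 2 ^+ 8 -> a * (m + 1) / 2 ^+ 7 <= J -> m * eta <= J * d / 2.
Proof.
move=> a0 d0 m0 le_eta leJ.
have h1 : m * eta <= m * (d * a / 2 ^+ 8) by rewrite ler_wpM2l.
have h2 : a * (m + 1) / 2 ^+ 7 * d <= J * d by rewrite ler_wpM2r.
have h3 : 0 <= d * a by rewrite mulr_ge0.
lra.
Qed.

(** The base [x' = 1 + (1 + eta) * (x - 1)] is chosen so that losing one unit
    of spread with probability [m * eta] outweighs the growth from [x]. *)
Lemma base_growth (x eta c : R) (m : nat) : 1 <= x -> 0 <= eta ->
  let x' := 1 + (1 + eta) * (x - 1) in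
  c <= 1 - m.+1%:R * eta ->
  x' ^+ m + x' ^+ m * (x' - 1) * c <= x ^+ m.+1.
Proof.
move=> x1 e0 x' cle.
have xx' : x <= x' by rewrite /x'; nra.
have x'0 : 0 < x' by lra.
have h : x' ^+ m * (x' - m.+1%:R * (x' - x)) <= x ^+ m.+1.
  have := @expr_tangent x' (x' - x) m x'0.
  by rewrite (_ : x' - (x' - x) = x); [apply; lra | ring].
apply: le_trans h; rewrite -mulrA -[X in X + _]mulr1 -mulrDr.
rewrite ler_wpM2l ?exprn_ge0 ?(ltW x'0) //.
have s1 : (x' - 1) * c <= (x' - 1) * (1 - m.+1%:R * eta) by rewrite ler_wpM2l //; lra.
have s2 : m.+1%:R * (x' - x) <= (x' - 1) * (m.+1%:R * eta).
  rewrite (_ : x' - x = eta * (x - 1)); last by rewrite /x'; ring.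
  rewrite mulrA [leRHS]mulrC ler_wpM2l ?mulr_ge0 //; lra.
lra.
Qed.

End Estimates.

(** * Sets with few connectors are rare *)

Section Rare.
Variables (R : realType) (G : sgraph) (t p : R).
Hypotheses (t0 : 0 <= t) (tG : tough t G) (p01 : 0 <= p <= 1).
Implicit Types (V U I : {set G}) (q x : R).
Let a := p * t.

(** With at most one component left there is nothing to join. *)
Definition rich V : bool :=
  (spread V <= 1)%N || (a * (spread V)%:R / 2 ^+ 7 <= #|connectors V|%:R).

Definition best_colouring V : {set G} :=
  odflt finset.set0
    [pick S : {set G} | closed_in V S && (#|borders V| <= 4 * #|front V S|)%N].

Lemma best_colouringP V :
  closed_in V (best_colouring V) /\
  (#|borders V| <= 4 * #|front V (best_colouring V)|)%N.
Proof.
rewrite /best_colouring; case: pickP => [S /andP[]//|none].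
by have [S cS bS] := front_average V; have := none S; rewrite cS bS.
Qed.

(** By [switching]: the [2 ^- spread V] and [2 ^- #|connectors V|] lost there
    are outweighed by the gain of [expR (p / 8)] per vertex of the front. *)
Lemma rare_borders q : p / 2 <= q <= 1 -> 2 ^+ 8 <= a ->
  \sum_(V | ~~ rich V && (t * (spread V)%:R / 2 <= #|borders V|%:R))
    weight q V * expR (a * (spread V)%:R / 2 ^+ 8) <= 1.
Proof.
move=> /andP[pq q1] a256; have /andP[p0 p1] := p01.
have q01 : 0 <= q <= 1 by lra.
apply: le_trans (@switching R G q _ best_colouring q01 _); last first.
  by move=> V _; have [] := best_colouringP V.
apply: ler_sum => V /andP[]; rewrite negb_or -ltnNge -ltNge => /andP[k2 ltJ] geB.
have [cS bS] := best_colouringP V.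
rewrite ler_wpM2l ?weight_ge0 //.
set S := best_colouring V in cS bS *; set k := spread V in k2 ltJ geB *.
set j := #|_ :&: _|; set f := #|front V S| in bS *.
have lej : j%:R <= a * k%:R / 2 ^+ 7 :> R.
  apply: le_trans (ltW ltJ); rewrite ler_nat; apply: subset_leq_card.
  exact: nbh_closed_connectors.
have lef : t * k%:R / 8 <= f%:R.
  have le4 : #|borders V|%:R <= 4 * f%:R :> R by rewrite -natrM ler_nat.
  have -> : t * k%:R / 8 = t * k%:R / 2 / 4 by field.
  by rewrite ler_pdivrMr // [leRHS]mulrC; apply: le_trans geB le4.
have k1 : 1 <= k%:R :> R by rewrite ler1n ltnW.
have grow : expR (p / 8 * f%:R) <= (1 + 2^-1 * q) ^+ f.
  rewrite expRM_natr lerXn2r ?nnegrE ?expR_ge0 //; first by lra.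
  apply: (@le_trans _ _ (1 + p / 4)); last by lra.
  have := @expR_half_le R (p / 4); rewrite (_ : p / 4 / 2 = p / 8); last by lra.
  by apply; lra.
apply: (@le_trans _ _ (expR (- k%:R) * expR (- j%:R) * expR (p / 8 * f%:R))).
  by rewrite -!expRD ler_expR; apply: border_exponent.
by rewrite !ler_pM ?mulr_ge0 ?expR_ge0 ?expRN_le_half.
Qed.

(** Without many connectors or borders a quarter of the cut consists of
    neighbours of the undominated set [I], all missed by [V].  The [#|I|] choices
    of a vertex cost [ln n] each, which is small against [a = p * t]. *)
Lemma rare_nbh q : p / 2 <= q <= 1 -> (0 < #|G|)%N -> 16 * ln #|G|%:R <= a ->
  \sum_(V | ~~ rich V && ~~ (t * (spread V)%:R / 2 <= #|borders V|%:R))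
    weight q V * expR (a * (spread V)%:R / 2 ^+ 8) <= expR 1.
Proof.
move=> /andP[pq q1] n0 lna; have /andP[p0 p1] := p01.
have q01 : 0 <= q <= 1 by lra.
apply: le_trans (expr_1Dn R #|G|).
have z0 : 0 <= #|G|%:R^-1 :> R by rewrite invr_ge0.
have cq : expR (p / 2) * (1 - q) <= 1.
  apply: (@le_trans _ _ (expR (p / 2) * expR (- (p / 2)))); last by rewrite -expRD subrr expR0.
  rewrite ler_wpM2l ?expR_ge0 //; apply: le_trans (expR_ge1Dx _); lra.
apply: le_trans (missed_nbh G q01 z0 (expR_ge0 _) cq).
apply: (@ler_sum_inj _ _ _ _ _ id) => //; last first.
  move=> V _; rewrite mulr_ge0 ?weight_ge0 // sumr_ge0 // => I _.
  by rewrite mulr_ge0 ?exprn_ge0 ?expR_ge0.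
move=> V /andP[]; rewrite negb_or -ltnNge -!ltNge => /andP[k2 ltJ] ltB.
rewrite ler_wpM2l ?weight_ge0 //.
have [I [dVI leI cut]] := tough_spread_cut t0 tG k2.
rewrite (bigD1 I) //= -[leLHS]addr0; apply: lerD; last first.
  by apply: sumr_ge0 => J _; rewrite mulr_ge0 ?exprn_ge0 ?expR_ge0.
set k := spread V in k2 ltJ ltB leI cut *.
have lnn0 : 0 <= ln #|G|%:R :> R by rewrite ln_ge0 // ler1n.
have -> : #|G|%:R^-1 = expR (- ln #|G|%:R) :> R by rewrite expRN expR_lnn.
rewrite -!expRM_natr -expRD ler_expR.
apply: nbh_exponent => //; first by rewrite ler_nat.
exact: nbh_share p01 t0 (ler0n _ _) cut (ltW ltJ) (ltW ltB).
Qed.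

Lemma rare_poor q : p / 2 <= q <= 1 -> (0 < #|G|)%N -> 2 ^+ 8 <= a ->
    16 * ln #|G|%:R <= a ->
  \sum_(V | ~~ rich V) weight q V * expR (a * (spread V)%:R / 2 ^+ 8) <= expR 1 + 1.
Proof.
move=> pq n0 a256 lna.
rewrite (bigID (fun V => t * (spread V)%:R / 2 <= #|borders V|%:R)) /= addrC.
by apply: lerD; [apply: rare_nbh|apply: rare_borders].
Qed.

(** * Adding a sparse random set *)

(** Each unit of spread above 1 is lost at rate at least [a / 2 ^+ 7], so the base
    of the exponential moment may grow from [x] to [x']. *)
Lemma rich_step d eta x x' V : rich V -> 0 <= d <= 1 -> #|G|%:R * d <= 1 ->
  0 <= eta -> eta <= d * a / 2 ^+ 8 -> 1 <= x ->
  x' = 1 + (1 + eta) * (x - 1) ->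
  mean d (fun U => x' ^+ (spread (V :|: U)).-1) <= x ^+ (spread V).-1.
Proof.
move=> richV /andP[d0 d1] nd1 e0 eda x1 x'E.
have d01 : 0 <= d <= 1 by rewrite d0.
have xx' : x <= x' by rewrite x'E; nra.
have x'1 : 1 <= x' by lra.
have x'0 : 0 < x' by lra.
have mono m m' : (m <= m')%N -> x' ^+ m <= x' ^+ m' by apply: ler_weXn2l.
case: (leqP (spread V) 1) => [le1|k2].
  apply: (@le_trans _ _ (mean d (fun _ : {set G} => 1))).
    apply: le_mean => // U.
    have := leq_trans (spreadU V U) le1; by case: (spread _) => [|[|]] // _; rewrite expr0.
  by rewrite mean_cst; move: le1; case: (spread V) => [|[|]] // _; rewrite expr0.
move: richV; rewrite /rich leqNgt k2 /=.
set J := connectors V => leJ.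
have [m kE] : exists m, spread V = m.+2 by case: (spread V) k2 => [|[|m]] // _; exists m.
rewrite kE /= in leJ *.
apply: (@le_trans _ _ (mean d (fun U => x' ^+ m + x' ^+ m * (x' - 1) * [disjoint U & J]%:R))).
  apply: le_mean => // U; case: (boolP [disjoint U & J]) => [_|hit].
    have -> : x' ^+ m + x' ^+ m * (x' - 1) * true%:R = x' ^+ m.+1 by rewrite exprSr /=; ring.
    by apply: mono; have := spreadU V U; rewrite kE; case: (spread _).
  rewrite mulr0 addr0; apply: mono.
  have : (spread (V :|: U) < spread V)%N by apply: spread_hit; rewrite setI_eq0.
  by rewrite kE; case: (spread _).
rewrite meanD mean_cst meanZ mean_disjoint.
have lnd : #|J|%:R * d <= 1.
  by apply: le_trans nd1; rewrite ler_wpM2r // ler_nat max_card.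
have miss := expr_miss d01 lnd.
have a0 : 0 <= a by rewrite mulr_ge0 //; case/andP: p01.
have rate : m.+1%:R * eta <= #|J|%:R * d / 2.
  by apply: (rich_rate a0 d0 (ler0n _ _) eda); rewrite natr1.
rewrite x'E; apply: base_growth => //; apply: le_trans miss _.
by rewrite lerD2l lerN2.
Qed.

(** Poor sets of spread [k] have total weight of order [expR (- a * k / 2 ^+ 8)]
    by [rare_poor], while [x'] is at most [expR (a / 2 ^+ 9)]. *)
Lemma moment_step q d eta x x' : p / 2 <= q <= 1 -> (0 < #|G|)%N -> 2 ^+ 8 <= a ->
    16 * ln #|G|%:R <= a ->
    0 <= d <= 1 -> #|G|%:R * d <= 1 -> 0 <= eta -> eta <= d * a / 2 ^+ 8 -> 1 <= x ->
  x' = 1 + (1 + eta) * (x - 1) -> x' <= expR (a / 2 ^+ 9) ->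
  mean (1 - (1 - q) * (1 - d)) (fun V => x' ^+ (spread V).-1) <=
    mean q (fun V => x ^+ (spread V).-1) + (expR 1 + 1) * expR (- (a / 2 ^+ 9)).
Proof.
move=> pq n0 a256 lna d01 nd1 e0 eda x1 x'E x'le; rewrite -mean_setU.
have /andP[p0 p1] := p01; have q01 : 0 <= q <= 1 by lra.
have xx' : x <= x' by rewrite x'E; nra.
have x'1 : 1 <= x' by lra.
have x'0 : 0 <= x' by lra.
apply: (@le_trans _ _ (mean q (fun V => x ^+ (spread V).-1 +
    (~~ rich V)%:R * x' ^+ (spread V).-1))).
  apply: le_mean => // V; case: (boolP (rich V)) => [richV|_].
    by rewrite mul0r addr0; apply: (rich_step richV d01 nd1 e0 eda x1 x'E).
  rewrite mul1r -[leLHS]add0r lerD ?exprn_ge0 ?(le_trans ler01) //.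
  rewrite -[leRHS](mean_cst G d) le_mean // => U.
  apply: ler_weXn2l => //.
  by rewrite -!subn1 leq_sub2r ?spreadU.
rewrite meanD lerD2l.
apply: (@le_trans _ _ (\sum_(V | ~~ rich V)
    (weight q V * expR (a * (spread V)%:R / 2 ^+ 8)) * expR (- (a / 2 ^+ 9)))).
  rewrite [leRHS]big_mkcond; apply: ler_sum => V _; case: ifP => [poor|_].
    rewrite mul1r -mulrA ler_wpM2l ?weight_ge0 //.
    move: poor; rewrite /rich negb_or -ltnNge => /andP[k2 _].
    apply: (@le_trans _ _ (expR (a / 2 ^+ 9) ^+ spread V)).
      apply: (@le_trans _ _ (x' ^+ spread V)); last by rewrite lerXn2r ?nnegrE ?expR_ge0.
      by apply: ler_weXn2l => //; apply: leq_pred.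
    rewrite -expRM_natr -expRD ler_expR.
    have : a <= a * (spread V)%:R by rewrite ler_peMr ?ler1n ?(ltnW k2) //; lra.
    lra.
  by rewrite mul0r mulr0.
by rewrite -mulr_suml ler_wpM2r ?expR_ge0 // rare_poor.
Qed.

(** The base starts at [1 + 1 / n], for which the moment is at most [expR 1]
    whatever the set, and its excess over 1 is multiplied by [1 + eta] in each of
    [n] rounds.  So it ends above [expR (p ^+ 2 * t / 2 ^+ 11) / n], and the
    factor [n] is absorbed because [p ^+ 2 * t] exceeds [2 ^+ 12 * ln n]. *)
Lemma moment_bound : t <= #|G|%:R -> 1 <= ln (#|G|%:R : R) ->
    2 ^+ 12 * ln #|G|%:R <= p ^+ 2 * t ->
  mean p (fun V => expR (p ^+ 2 * t / 2 ^+ 12) ^+ (spread V).-1) <= expR 1 + 1.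
Proof.
move=> tn lnn pt; have /andP[p0 p1] := p01.
have n0 : (0 < #|G|)%N.
  by rewrite lt0n; apply/eqP => n0; move: lnn; rewrite n0 ln0 //; lra.
set n : R := #|G|%:R in tn lnn pt *.
have npos : 0 < n by rewrite ltr0n.
have aE : p ^+ 2 * t = p * a by rewrite /a; ring.
have a0 : 0 <= a by rewrite mulr_ge0.
have paa : p * a <= a by rewrite ler_piMl.
have alarge : 2 ^+ 12 * ln n <= a by rewrite aE in pt; apply: le_trans pt paa.
have a256 : 2 ^+ 8 <= a by lra.
have lna : 16 * ln n <= a by lra.
pose d := p / (4 * n); pose eta := d * a / 2 ^+ 8.
have n1 : 1 <= n by rewrite ler1n.
have nd : n * d = p / 4 by rewrite /d; field; lra.
have d0 : 0 <= d by rewrite divr_ge0 // mulr_ge0 // ltW.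
have d01 : 0 <= d <= 1 by rewrite d0 /=; nra.
have nd1 : n * d <= 1 by rewrite nd; lra.
have e0 : 0 <= eta by apply: divr_ge0; [apply: mulr_ge0|apply: exprn_ge0].
have ne : n * eta = p * a / 2 ^+ 10.
  have -> : n * eta = (n * d) * a / 2 ^+ 8 by rewrite /eta; field.
  by rewrite nd; field.
have pan : p * a <= n.
  apply: (le_trans paa); apply: le_trans tn; rewrite /a ler_piMl //.
have e1 : eta <= 1 by nra.
pose D := (1 - d) ^+ #|G|.
have Dge : 1 - p / 4 <= D by rewrite -nd; apply: bernoulli.
have D0 : 0 < D by lra.
(* The first density is chosen so that [n] rounds of density [d] end at [p]. *)
pose q i := 1 - (1 - p) / D * (1 - d) ^+ i.
have q0le : (1 - p) / D <= 1 - p / 2.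
  rewrite ler_pdivrMr //; apply: (@le_trans _ _ ((1 - p / 2) * (1 - p / 4))); first by nra.
  by rewrite ler_wpM2l //; lra.
have qD0 : 0 <= (1 - p) / D by rewrite divr_ge0 ?subr_ge0 ?(ltW D0).
have qi i : p / 2 <= q i <= 1.
  have c0 : 0 <= (1 - d) ^+ i by rewrite exprn_ge0 // subr_ge0; case/andP: d01.
  have c1 : (1 - d) ^+ i <= 1 by rewrite exprn_ile1 //; lra.
  by rewrite /q; nra.
pose x i := 1 + (1 + eta) ^+ i / n.
have x1 i : 1 <= x i by rewrite /x lerDl divr_ge0 ?exprn_ge0 ?(ltW npos) //; lra.
have xS i : x i.+1 = 1 + (1 + eta) * (x i - 1) by rewrite /x exprS; field; lra.
have xle i : (i <= #|G|)%N -> x i <= expR (a / 2 ^+ 9).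
  move=> le_in; apply: (@le_trans _ _ (2 * expR (a / 2 ^+ 10))).
    have h1 : (1 + eta) ^+ i <= expR (a / 2 ^+ 10).
      apply: (@le_trans _ _ (expR eta ^+ #|G|)).
        apply: (@le_trans _ _ ((1 + eta) ^+ #|G|)); first by apply: ler_weXn2l => //; lra.
        by rewrite lerXn2r ?nnegrE ?expR_ge0 ?expR_ge1Dx //; lra.
      by rewrite -expRM_natl ler_expR -/n ne; lra.
    have h2 : (1 + eta) ^+ i / n <= expR (a / 2 ^+ 10).
      rewrite ler_pdivrMr //; apply: le_trans h1 _; rewrite ler_peMr ?expR_ge0 //.
    have h3 : 1 <= expR (a / 2 ^+ 10).
      by rewrite -[leLHS](expR0 R) ler_expR divr_ge0 ?exprn_ge0.
    by rewrite /x; lra.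
  have -> : a / 2 ^+ 9 = a / 2 ^+ 10 + a / 2 ^+ 10 by field.
  rewrite expRD ler_wpM2r ?expR_ge0 //; apply: le_trans (two_le_expR1 R) _.
  by rewrite ler_expR; lra.
pose err := (expR 1 + 1) * expR (- (a / 2 ^+ 9)).
have iter i : (i <= #|G|)%N ->
    mean (q i) (fun V => x i ^+ (spread V).-1) <= expR 1 + i%:R * err.
  elim: i => [_|i IHi lt_in].
    rewrite mul0r addr0 /x expr0 div1r; apply: le_trans (expr_1Dn R #|G|).
    have q01 : 0 <= q 0%N <= 1 by have := qi 0%N; lra.
    rewrite -[leRHS](mean_cst G (q 0%N)); apply: le_mean => // V.
    apply: ler_weXn2l; first by rewrite lerDl invr_ge0 (ltW npos).
    exact: leq_trans (leq_pred _) (spread_max V).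
  have -> : q i.+1 = 1 - (1 - q i) * (1 - d) by rewrite /q exprSr; ring.
  apply: le_trans (moment_step (qi i) n0 a256 lna d01 nd1 e0 (lexx _) (x1 i) (xS i) (xle _ lt_in)) _.
  have := IHi (ltnW lt_in); rewrite -/err -natr1; lra.
have qn : q #|G| = p by rewrite /q -/D divfK ?lt0r_neq0 //; ring.
have := iter #|G| (leqnn _); rewrite qn => mom.
have errle : #|G|%:R * err <= 1.
  rewrite -[X in X%:R * _]/#|G| -(expR_lnn R n0) -/n /err.
  have c2 : expR 1 + 1 <= expR (1 + 1) :> R.
    by rewrite expRD; have := two_le_expR1 R; nra.
  apply: (@le_trans _ _ (expR (ln n) * (expR (1 + 1) * expR (- (a / 2 ^+ 9))))).
    by rewrite ler_wpM2l ?expR_ge0 // ler_wpM2r ?expR_ge0.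
  by rewrite -!expRD -[leRHS]expR0 ler_expR; lra.
apply: le_trans (_ : _ <= expR 1 + #|G|%:R * err) _; last by lra.
apply: le_trans mom; apply: le_mean => // V.
rewrite lerXn2r ?nnegrE ?expR_ge0 ?(le_trans ler01) //.
apply: (@le_trans _ _ ((1 + eta) ^+ #|G| / n)); last by rewrite /x lerDr.
have g1 : expR (eta / 2) ^+ #|G| <= (1 + eta) ^+ #|G|.
  rewrite lerXn2r ?nnegrE ?expR_ge0 ?expR_half_le //; first by lra.
  by rewrite e0.
rewrite ler_pdivlMr //; apply: le_trans g1.
rewrite -[n in leLHS]expR_lnn // -/n -expRM_natl -expRD ler_expR.
have -> : #|G|%:R * (eta / 2) = n * eta / 2 by rewrite /n; field.
rewrite ne aE; rewrite aE in pt; lra.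
Qed.

End Rare.

From mathcomp Require Import all_classical all_reals all_analysis.
Import numFieldNormedType.Exports.

(** * Toughness of a random induced subgraph *)

Lemma large_exponent (R : realType) (l z : R) : 1 <= l -> 2 ^+ 18 * l <= z ->
  2 ^+ 12 * l <= z / 4 /\ 2 <= z / 2 ^+ 16.
Proof. by move=> l1 lz; split; lra. Qed.

Section RandomInduced.
Variables (R : realType) (G : sgraph) (t p : R).
Hypotheses (t0 : 0 <= t) (tG : tough t G) (p01 : 0 <= p <= 1).
Hypotheses (lnn : 1 <= ln (#|G|%:R : R)) (pt : 2 ^+ 18 * ln #|G|%:R <= p ^+ 2 * t).
Let s := p ^+ 2 * t / 2 ^+ 16.

(** If [S] violates toughness in [A], a further sparsification avoids [S] with
    probability [2 ^- #|S|], and then has spread at least [k]. *)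
Lemma violation_moment (A : {set G}) :
  ~ tough s (induced_subgraph A) ->
  expR (2 * s) <= mean 2^-1 (fun U => expR ((p / 2) ^+ 2 * t / 2 ^+ 12) ^+ (spread (A :&: U)).-1).
Proof.
move=> /not_tough_spread[S [k [k2 kS ltS]]].
have s0 : 0 <= s by rewrite divr_ge0 ?exprn_ge0 // mulr_ge0 ?exprn_ge0; case/andP: p01.
have -> : (p / 2) ^+ 2 * t / 2 ^+ 12 = 4 * s by rewrite /s; field.
have half01 := half_in01 R.
set x := expR (4 * s).
have x1 : 1 <= x by rewrite -[leLHS](expR0 R) ler_expR mulr_ge0.
apply: (@le_trans _ _ (mean 2^-1 (fun U => x ^+ k.-1 * [disjoint U & S]%:R))); last first.
  apply: le_mean => // U; case: (boolP [disjoint U & S]) => [dUS|_]; last first.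
    by rewrite mulr0 exprn_ge0 ?(le_trans ler01).
  rewrite mulr1; apply: ler_weXn2l => //.
  rewrite -!subn1; apply: leq_sub2r; apply: leq_trans kS _; apply: spread_anti.
  apply/fintype.subsetP => v; rewrite !finset.inE => /andP[-> vU].
  by rewrite andbT (disjointFr dUS vU).
rewrite meanZ mean_disjoint.
have -> : 1 - 2^-1 = 2^-1 :> R by field.
apply: (@le_trans _ _ (x ^+ k.-1 * expR (- #|S|%:R))); last first.
  by rewrite ler_wpM2l ?expRN_le_half // exprn_ge0 ?(le_trans ler01).
rewrite /x -expRM_natr -expRD ler_expR.
have [m kE] : exists m, k = m.+2 by case: (k) k2 => [|[|m]] // _; exists m.
rewrite kE /= in ltS *; move: ltS; move: (#|S|%:R : R) => c.
rewrite -[m.+2%:R]natr1 -[m.+1%:R]natr1.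
have : 0 <= s * m%:R by rewrite mulr_ge0.
move: (m%:R : R) => y; clear -s0; move: s s0 => z z0 *; lra.
Qed.

Lemma tough_mean :
  mean p (fun A : {set G} => (~~ `[< tough s (induced_subgraph A) >])%:R) <= expR (- s).
Proof.
have /andP[p0 p1] := p01.
case: (boolP [exists x : G, exists y : G, (x != y) && ~~ adj x y]); last first.
  rewrite negb_exists => /forallP complete.
  have adjG (x y : G) : x != y -> adj x y.
    move=> nxy; move/(_ x): complete; rewrite negb_exists => /forallP/(_ y).
    by rewrite nxy /= negbK.
  apply: (@le_trans _ _ (mean p (fun _ : {set G} => 0))); last by rewrite mean_cst expR_ge0.
  apply: le_mean => // A; case: asboolP => //= nt.
  have [S [k [k2 kS _]]] := not_tough_spread nt.
  by have := leq_trans k2 (leq_trans kS (spread_complete _ adjG)).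
case/existsP => x /existsP[y /andP[nxy naxy]].
have tn := tough_le_card t0 tG nxy naxy.
have mom : mean (p / 2) (fun V : {set G} => expR ((p / 2) ^+ 2 * t / 2 ^+ 12) ^+ (spread V).-1)
    <= expR 1 + 1.
  apply: moment_bound => //.
    by apply/andP; split; lra.
  have -> : (p / 2) ^+ 2 * t = p ^+ 2 * t / 4 by field.
  by case: (large_exponent lnn pt).
rewrite -[p / 2]/(p * 2^-1) -mean_setI in mom.
have [_ s2] := large_exponent lnn pt; rewrite -/s in s2.
rewrite -(ler_pM2l (expR_gt0 (2 * s))) -meanZ.
have -> : expR (2 * s) * expR (- s) = expR s by rewrite -expRD; congr expR; ring.
apply: (@le_trans _ _ (expR 1 + 1)).
  apply: le_trans mom; apply: le_mean => // A.
  case: asboolP => [_|nt]; last by rewrite /= mulr1; apply: violation_moment.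
  rewrite /= mulr0; apply: sumr_ge0 => U _.
  by rewrite mulr_ge0 ?exprn_ge0 ?expR_ge0 ?weight_ge0 ?half_in01.
apply: (@le_trans _ _ (expR 2)); last by rewrite ler_expR.
have -> : expR 2 = expR 1 * expR 1 :> R by rewrite -expRD.
by have := two_le_expR1 R; nra.
Qed.

End RandomInduced.

(** * The law of a random vertex set *)

Section Law.
Variables (d : measure_display) (Omega : measurableType d) (R : realType).
Variables (P : probability Omega R) (T : finType) (p : R) (V : Omega -> {set T}).
Hypothesis VP : random_subset P p V.
Local Open Scope classical_set_scope.

Lemma measurable_event (Q : pred {set T}) : measurable [set w | Q (V w)].
Proof.
have [[mE _] _] := VP.
pose E v := [set w | v \in V w].
have mA A : measurable [set w | V w = A].
  have -> : [set w | V w = A] = \bigcap_(v in [set: T]) (if v \in A then E v else ~` E v).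
    apply/seteqP; split => w /=.
      by move=> <- v _; case: ifP => [vV //|/negbT vV]; apply/negP.
    move=> inE; apply/finset.setP => v; have := inE v I.
    by case: ifP => vA /=; [move=> ->|move/negP/negbTE].
  apply: fin_bigcap_measurable => [|v _]; first exact: finite_finset.
  by case: ifP => _; [apply: mE|apply/measurableC/mE].
have -> : [set w | Q (V w)] = \bigcup_(A in [set A | Q A]) [set w | V w = A].
  by apply/seteqP; split => w /=; [exists (V w)|case=> A /= QA ->].
by apply: fin_bigcup_measurable => [|A _]; [apply: finite_finset|apply: mA].
Qed.

(** Inclusion-exclusion, one excluded vertex at a time. *)
Lemma prob_pattern (K J : {set T}) : [disjoint J & K]%B ->
  P [set w | (J \subset V w) && [disjoint K & V w]%B] =
    (p ^+ #|J| * (1 - p) ^+ #|K|)%:E.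
Proof.
have [[_ indep] pE] := VP.
have disjU1 v (A B : {set T}) :
    [disjoint (v |: A)%SET & B]%B = (v \notin B) && [disjoint A & B]%B.
  by rewrite !finset.disjoints_subset finset.subUset finset.sub1set finset.in_setC.
have [n] := ubnP #|K|; elim: n K J => // n IHn K J leKn dJK.
case: (finset.set_0Vmem K) => [K0|[v vK]].
  rewrite K0 finset.cards0 expr0 mulr1.
  have -> : [set w | (J \subset V w) && [disjoint finset.set0 & V w]%B] =
      \bigcap_(v in [set` J]) [set w | v \in V w].
    apply/seteqP; split => w /=.
      by move=> /andP[/fintype.subsetP sJ _] v /= vJ; apply: sJ.
    move=> h; apply/andP; split; first by apply/fintype.subsetP => v vJ; apply: h.
    by apply/pred0P => v /=; rewrite finset.in_set0.
  rewrite indep (eq_bigr (fun=> p%:E)) => [|v _]; last exact: pE.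
  by rewrite prodEFin prodr_const.
pose K' := (K :\ v)%SET; pose J' := (v |: J)%SET.
have vJ : v \notin J by rewrite (disjointFl dJK vK).
have cK : #|K| = #|K'|.+1 by rewrite (finset.cardsD1 v) vK.
have ltK : (#|K'| < n)%N by rewrite cK in leKn.
have dJK' : [disjoint J & K']%B.
  by apply: disjointWr dJK; apply: finset.subsetDl.
have dJ'K' : [disjoint J' & K']%B.
  by rewrite disjU1 dJK' andbT !finset.inE eqxx.
have split_v : P [set w | (J \subset V w) && [disjoint K' & V w]%B] =
    (P ([set w | (J \subset V w) && [disjoint K' & V w]%B] `\` [set w | v \in V w]) +
     P ([set w | (J \subset V w) && [disjoint K' & V w]%B] `&` [set w | v \in V w]))%E.
  apply: measureDI; last exact: (measurable_event (fun A => v \in A)).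
  exact: (measurable_event (fun A => (J \subset A) && [disjoint K' & A]%B)).
move: split_v; rewrite (IHn K' J ltK dJK').
have -> : [set w | (J \subset V w) && [disjoint K' & V w]%B] `\` [set w | v \in V w] =
    [set w | (J \subset V w) && [disjoint K & V w]%B].
  have KE : K = (v |: K')%SET by rewrite finset.setD1K.
  apply/seteqP; split => w /=; rewrite KE disjU1.
    by move=> [/andP[-> ->] /negP ->].
  by move=> /and3P[-> vV ->]; split=> //; apply/negP.
have -> : [set w | (J \subset V w) && [disjoint K' & V w]%B] `&` [set w | v \in V w] =
    [set w | (J' \subset V w) && [disjoint K' & V w]%B].
  apply/seteqP; split => w /=; rewrite finset.subUset finset.sub1set.
    by move=> [/andP[-> ->] ->].
  by move=> /andP[/andP[-> ->] ->].
rewrite (IHn K' J' ltK dJ'K') finset.cardsU1 vJ cK !exprS => /esym eqP.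
have : P [set w | (J \subset V w) && [disjoint K & V w]%B] \is a fin_num.
  apply: fin_num_measure.
  exact: (measurable_event (fun A => (J \subset A) && [disjoint K & A]%B)).
move: eqP; case: (P _) => // r /eqP; rewrite -EFinD eqe => /eqP eqr _.
by congr _%:E; rewrite -[r](addrK (p * p ^+ #|J| * (1 - p) ^+ #|K'|)) eqr; ring.
Qed.

Lemma prob_atom (A : {set T}) : P [set w | V w = A] = (weight p A)%:E.
Proof.
have dA : [disjoint A & (~: A)%SET]%B by rewrite finset.disjoints_subset finset.setCK.
have -> : [set w | V w = A] = [set w | (A \subset V w) && [disjoint (~: A)%SET & V w]%B].
  apply/seteqP; split => w /=; first by move=> ->; rewrite subxx disjoint_sym.
  move=> /andP[sAV]; rewrite disjoint_sym finset.disjoints_subset finset.setCK => sVA.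
  by apply/eqP; rewrite finset.eqEsubset sVA.
rewrite (prob_pattern dA); congr _%:E; rewrite /weight (bigID [in A]) /=; congr (_ * _).
  by rewrite -prodr_const; apply: eq_bigr => v ->.
rewrite -prodr_const; apply: eq_big => [v|v]; rewrite ?finset.inE // => /negbTE ->.
by [].
Qed.

Lemma prob_event (Q : pred {set T}) :
  P [set w | Q (V w)] = (mean p (fun A => (Q A)%:R))%:E.
Proof.
have seqE (l : seq {set T}) : uniq l ->
    P [set w | V w \in l] = (\sum_(A <- l) weight p A)%:E.
  elim: l => [_|A l IHl /= /andP[Al ul]].
    rewrite big_nil (_ : [set w | V w \in [::]] = set0) ?measure0 //.
    by apply/seteqP; split => w.
  rewrite big_cons EFinD -(IHl ul) -prob_atom -measureU.
  - congr (P _); apply/seteqP; split => w /=; rewrite in_cons.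
      by move=> /orP[/eqP ->|]; [left|right].
    by move=> [->|->]; rewrite ?eqxx ?orbT.
  - have -> : [set w | V w = A] = [set w | V w == A].
      by apply/seteqP; split => w /= /eqP.
    exact: (measurable_event (fun B => B == A)).
  - exact: (measurable_event (fun B => B \in l)).
  - by apply/seteqP; split => // w [/= ->]; rewrite (negbTE Al).
have -> : [set w | Q (V w)] = [set w | V w \in enum Q].
  by apply/seteqP; split => w /=; rewrite mem_enum.
rewrite seqE ?enum_uniq // big_enum /= big_mkcond; congr _%:E.
by apply: eq_bigr => A _; rewrite unfold_in; case: (Q A); rewrite ?mulr1 ?mulr0.
Qed.

End Law.

Lemma ln_ge1 (R : realType) (n : nat) : (4 <= n)%N -> 1 <= ln (n%:R : R).
Proof.
move=> n4; have n0 : 0 < n%:R :> R by rewrite ltr0n; apply: leq_trans n4.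
rewrite -ler_expR lnK ?posrE //; apply: (@le_trans _ _ 4%:R); last by rewrite ler_nat.
have h : expR (1 / 2) <= 1 + 1 :> R by apply: expR_half_le; rewrite ler01 lexx.
have -> : expR 1 = expR (1 / 2) * expR (1 / 2) :> R.
  by rewrite -expRD; congr expR; field.
have := expR_ge0 (1 / 2 : R); move: (expR _) h => x h x0; nra.
Qed.

Local Open Scope classical_set_scope.
Local Open Scope ring_scope.

Theorem theorem1p2 (R : realType) :
  exists c1 c2 : R, 0 < c1 /\ 0 < c2 /\
  forall f : nat -> R, f @ \oo --> +oo%R ->
  exists N : nat, forall (G : sgraph) (t p : R),
    (N <= #|G|)%N ->
    0 <= t -> tough t G ->
    0 <= p <= 1 ->
    f #|G| <= p ^+ 2 * t / ln (#|G|%:R) ->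
  forall (d : measure_display) (Omega : measurableType d)
    (P : probability Omega R) (V : Omega -> {set G}),
    random_subset P p V ->
    ((1 - 2 `^ (- (c2 * (p ^+ 2 * t))))%:E <=
      P [set w | tough (c1 * (p ^+ 2 * t)) (induced_subgraph (V w))])%E.
Proof.
have c0 : 0 < (2 ^+ 16)^-1 :> R by rewrite invr_gt0 exprn_gt0.
exists (2 ^+ 16)^-1, (2 ^+ 16)^-1; split=> //; split=> // f foo.
have /cvgryPge/(_ (2 ^+ 18))[N _ fN] := foo.
exists (maxn N 4) => G t p; rewrite geq_max => /andP[/fN fG n4] t0 tG p01 fle.
move=> d Omega P V VP.
have lnn := @ln_ge1 R _ n4.
have pt : 2 ^+ 18 * ln #|G|%:R <= p ^+ 2 * t.
  by rewrite -ler_pdivlMr ?(lt_le_trans ltr01) //; apply: le_trans fG fle.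
rewrite ![_^-1 * _]mulrC; set s := p ^+ 2 * t / 2 ^+ 16.
have -> : [set w | tough s (induced_subgraph (V w))] =
    [set w | `[< tough s (induced_subgraph (V w)) >]].
  by apply/seteqP; split => w /=; [move/asboolP|move/asboolP].
rewrite (prob_event VP (fun A : {set G} => `[< tough s (induced_subgraph A) >])) lee_fin.
have le_mu := tough_mean t0 tG p01 lnn pt.
have sum1 : mean p (fun A : {set G} => (`[< tough s (induced_subgraph A) >])%:R) +
    mean p (fun A : {set G} => (~~ `[< tough s (induced_subgraph A) >])%:R) = 1.
  rewrite -meanD -[RHS](mean_cst G p); apply: eq_bigr => A _.
  by case: asboolP; rewrite /= ?addr0 ?add0r.
rewrite lerBlDr -[leLHS]sum1 lerD2l; apply: le_trans le_mu _.
rewrite -/s /powR pnatr_eq0 /= ler_expR !mulNr lerN2 ler_piMr //.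
  by rewrite /s divr_ge0 ?exprn_ge0 // mulr_ge0 ?exprn_ge0 //; case/andP: p01.
have := @le_ln1Dx R 1; rewrite (_ : 1 + 1 = 2) //; apply.
exact: lt_trans (ltrN10 _) ltr01.
Qed.
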